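(* Let $A$ be a commutative monoid in the category of based $\mathcal{C}_2$-spaces. Then both $BB^\sigma A$ and $B^\sigma BA$ are well-defined and have natural commutative monoid structures. Moreover, they are $\mathcal{C}_2$-homeomorphic to each other.
   Context: $\mathcal{C}_2$ is the group with two elements, with generator $\tau$. A commutative monoid $A$ in based $\mathcal{C}_2$-spaces is a commutative topological monoid with a $\mathcal{C}_2$-action satisfying $\tau(xy)=\tau(x)\tau(y)$, with unit $e$ (fixed by $\tau$). Twisted monoid: a $\mathcal{C}_2$-space $A$ which is non-equivariantly a topological monoid, such that $\tau(xy)=\tau(y)\tau(x)$. A commutative monoid in based $\mathcal{C}_2$-spaces is both a monoid in based $\mathcal{C}_2$-spaces and a twisted monoid. Ordinary bar construction $BA$ (for a monoid $A$ in based $\mathcal{C}_2$-spaces): the geometric realization of the simplicial $\mathcal{C}_2$-space $B_nA=A^n$ with the usual faces and degeneracies ($d_0$ drops $a_1$, $d_i$ multiplies $a_ia_{i+1}$ for $0<i<n$, $d_n$ drops $a_n$, $s_i$ inserts $e$ after $a_i$), with $\mathcal{C}_2$ acting diagonally on $A^n$ and trivially on $\Delta^n$. Twisted bar construction $B^\sigma A$ (for a twisted monoid $A$): the geometric realization $\coprod_nA^n\times\Delta^n/\sim$ of the same underlying simplicial space, with $\mathcal{C}_2$-action induced by $\tau(a_1,\dots,a_n)=(\tau a_n,\dots,\tau a_1)$ on $A^n$ and $\tau(v_0,\dots,v_n)=(v_n,\dots,v_0)$ on $\Delta^n=\{(v_0,\dots,v_n)\in[0,1]^{n+1}:\sum v_i=1\}$.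 When $A$ is commutative, $BA$ and $B^\sigma A$ are given the products induced from levelwise multiplication, using that geometric realization commutes with products. *)

(* Defs.v *)
From HB Require Import structures.
From Stdlib Require Import Relation_Operators.
From mathcomp Require Import all_boot all_order all_algebra generic_quotient zify.
From mathcomp Require Import boolp classical_sets functions reals.
From mathcomp Require Import topology.

Set Implicit Arguments.
Unset Strict Implicit.
Unset Printing Implicit Defensive.

Import Order.TTheory GRing.Theory Num.Theory.
Import numFieldTopology.Exports.
Local Open Scope classical_set_scope.
Local Open Scope ring_scope.
Local Open Scope quotient_scope.

(** Geometric realization commutes with products only in a convenient category
    of spaces.  "Space" therefore means compactly generated space (k-space), in
    the sense of testing on all maps from compact Hausdorff spaces, and products
    carry the k-ification of the product topology.  No separation axiom is
    imposed. *)

Definition kopen (T : topologicalType) (U : set T) : Prop :=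
  forall (K : topologicalType) (u : K -> T),
    compact [set: K] -> hausdorff_space K -> continuous u -> open (u @^-1` U).

Definition kspace (T : topologicalType) : Prop :=
  forall U : set T, kopen U -> open U.

Definition kify (T : Type) : Type := T.

Section Kify.
Variable T : topologicalType.

Let kopenT : kopen [set: T].
Proof. by move=> K u _ _ _; rewrite preimage_setT; exact: openT. Qed.

Let kopenI : setI_closed (@kopen T).
Proof.
move=> U V oU oV K u cK hK cu; rewrite preimage_setI.
by apply: openI; [exact: oU | exact: oV].
Qed.

Let kopen_bigU (I : Type) (f : I -> set T) :
  (forall i, kopen (f i)) -> kopen (\bigcup_i f i).
Proof.
move=> of_ K u cK hK cu; rewrite preimage_bigcup.
by apply: bigcup_open => i _; exact: of_.
Qed.

HB.instance Definition _ := Choice.on (kify T).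
HB.instance Definition _ :=
  isOpenTopological.Build (kify T) kopenT kopenI kopen_bigU.

End Kify.

Definition kprod (X Y : topologicalType) : topologicalType := kify (X * Y)%type.

Definition kpow (X : topologicalType) (n : nat) : topologicalType :=
  kify {ptws 'I_n -> X}.

Definition homeomorphism (X Y : topologicalType) (f : X -> Y) : Prop :=
  exists g : Y -> X, [/\ cancel f g, cancel g f, continuous f & continuous g].

Section Simplex.
Variable R : realType.

Definition simplex_set (n : nat) : set {ptws 'I_n.+1 -> R} :=
  [set v | (forall i, 0 <= v i <= 1) /\ \sum_i v i = 1].

Arguments simplex_set n : clear implicits.

Definition simplex (n : nat) : topologicalType := set_type (simplex_set n).

Lemma simplexP n (v : 'I_n.+1 -> R) :
  (forall i, 0 <= v i) -> \sum_i v i = 1 -> v \in simplex_set n.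
Proof.
move=> v0 v1; apply/mem_set; split => // i; rewrite v0 /= -v1.
by rewrite (bigD1 i) //= lerDl sumr_ge0.
Qed.

Lemma simplex_ge0 n (v : simplex n) i : 0 <= sval v i.
Proof. by case: v => v /= /set_mem[/(_ i)/andP[]]. Qed.

Lemma simplex_sum n (v : simplex n) : \sum_i sval v i = 1.
Proof. by case: v => v /= /set_mem[]. Qed.

(** The affine map sending the vertex [i] to the vertex [f i]. *)
Definition push_fun m n (f : 'I_m.+1 -> 'I_n.+1) (v : simplex m) :
    'I_n.+1 -> R :=
  fun j => \sum_(i | f i == j) sval v i.

Lemma push_subproof m n (f : 'I_m.+1 -> 'I_n.+1) (v : simplex m) :
  push_fun f v \in simplex_set n.
Proof.
apply: simplexP => [j|]; first by apply: sumr_ge0 => i _; exact: simplex_ge0.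
rewrite -(simplex_sum v) (partition_big f predT) //=.
Qed.

Definition push m n (f : 'I_m.+1 -> 'I_n.+1) (v : simplex m) : simplex n :=
  exist _ (push_fun f v) (push_subproof f v).

(** [coface i] inserts a zero in position [i]; [codegen i] adds the coordinates
    [i] and [i.+1]. *)
Definition coface n (i : 'I_n.+2) : simplex n -> simplex n.+1 := push (lift i).

Definition codegen n (i : 'I_n.+1) : simplex n.+1 -> simplex n :=
  push (fun k : 'I_n.+2 => inord (unbump i k)).

Lemma simplex_rev_subproof n (v : simplex n) :
  (fun i => sval v (rev_ord i)) \in simplex_set n.
Proof.
apply: simplexP => [j|]; first exact: simplex_ge0.
by rewrite -(simplex_sum v) [RHS](reindex_inj rev_ord_inj).
Qed.

Definition simplex_rev n (v : simplex n) : simplex n :=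
  exist _ (fun i => sval v (rev_ord i)) (simplex_rev_subproof v).

Lemma vertex_subproof : (fun _ => 1) \in simplex_set 0.
Proof. by apply: simplexP => [i|]; [exact: ler01 | rewrite big_ord1]. Qed.

Definition vertex : simplex 0 := exist _ (fun _ => 1) vertex_subproof.

End Simplex.

Arguments simplex_set R n : clear implicits.

Lemma simplex_eq (R : realType) n (v w : simplex R n) :
  (forall i, sval v i = sval w i) -> v = w.
Proof. by move=> h; apply: val_inj; apply: funext => i; exact: h. Qed.

Lemma coface_rev (R : realType) n (i : 'I_n.+2) (v : simplex R n) :
  simplex_rev (coface i v) = coface (rev_ord i) (simplex_rev v).
Proof.
apply: simplex_eq => j /=; rewrite /push_fun [RHS](reindex_inj rev_ord_inj) /=.
apply: eq_big => [k|k _]; last by rewrite rev_ordK.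
apply/eqP/eqP => /(congr1 val) /= h; apply: val_inj => /=; move: h;
  rewrite /bump; have := ltn_ord i; have := ltn_ord j; have := ltn_ord k; lia.
Qed.

Lemma codegen_rev (R : realType) n (i : 'I_n.+1) (v : simplex R n.+1) :
  simplex_rev (codegen i v) = codegen (rev_ord i) (simplex_rev v).
Proof.
apply: simplex_eq => j /=; rewrite /push_fun [RHS](reindex_inj rev_ord_inj) /=.
apply: eq_big => [k|k _]; last by rewrite rev_ordK.
have ub (l : 'I_n.+1) (m : 'I_n.+2) : (unbump l m < n.+1)%N.
  by rewrite /unbump; have := ltn_ord l; have := ltn_ord m; lia.
have:= ub i k; have:= ub (rev_ord i) (rev_ord k).
rewrite -!val_eqE /= => h1 h2; rewrite !inordK //.
rewrite /unbump; have := ltn_ord i; have := ltn_ord j; have := ltn_ord k; lia.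
Qed.

(** The data of a simplicial space.  Neither the simplicial identities nor
    continuity are part of the record: it is only used for bar constructions
    and their products. *)
Record sspace := SSpace {
  level :> nat -> topologicalType;
  face : forall n, 'I_n.+2 -> level n.+1 -> level n;
  degen : forall n, 'I_n.+1 -> level n -> level n.+1 }.

Definition sprod (X Y : sspace) : sspace :=
  @SSpace (fun n => kprod (X n) (Y n))
    (fun n i p => (face i p.1, face i p.2))
    (fun n i p => (degen i p.1, degen i p.2)).

Definition simplicial_map (X Y : sspace) (f : forall n, X n -> Y n) : Prop :=
  (forall n (i : 'I_n.+2) x, f n (face i x) = face i (f n.+1 x)) /\
  (forall n (i : 'I_n.+1) x, f n.+1 (degen i x) = degen i (f n x)).

(** Order-reversing analogue of a simplicial map. *)
Definition antisimplicial_map (X Y : sspace) (f : forall n, X n -> Y n) :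
    Prop :=
  (forall n (i : 'I_n.+2) x, f n (face i x) = face (rev_ord i) (f n.+1 x)) /\
  (forall n (i : 'I_n.+1) x, f n.+1 (degen i x) = degen (rev_ord i) (f n x)).

Section Realization.
Variable R : realType.

Definition cells (X : sspace) : topologicalType :=
  {n : nat & kprod (X n) (simplex R n)}.

Definition cell (X : sspace) n (x : X n) (v : simplex R n) : cells X :=
  existT (fun n => kprod (X n) (simplex R n)) n (x, v).

Inductive glue_step (X : sspace) : cells X -> cells X -> Prop :=
| glue_face n (i : 'I_n.+2) (x : X n.+1) (v : simplex R n) :
    glue_step (cell (face i x) v) (cell x (coface i v))
| glue_degen n (i : 'I_n.+1) (x : X n) (v : simplex R n.+1) :
    glue_step (cell (degen i x) v) (cell x (codegen i v)).

Definition glue (X : sspace) : rel (cells X) :=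
  fun a b => `[< clos_refl_sym_trans _ (@glue_step X) a b >].

Lemma glue_refl X : reflexive (@glue X).
Proof. by move=> a; apply/asboolP; exact: rst_refl. Qed.

Lemma glue_sym X : symmetric (@glue X).
Proof. by move=> a b; apply/asboolP/asboolP => ?; exact: rst_sym. Qed.

Lemma glue_trans X : transitive (@glue X).
Proof.
move=> b a c /asboolP ab /asboolP bc; apply/asboolP; exact: rst_trans ab bc.
Qed.

Definition glue_equiv X :=
  EquivRel (@glue X) (@glue_refl X) (@glue_sym X) (@glue_trans X).

Definition realization (X : sspace) : topologicalType :=
  quotient_topology {eq_quot (glue_equiv X)}.

Definition rpi (X : sspace) n (x : X n) (v : simplex R n) : realization X :=
  \pi_({eq_quot (glue_equiv X)}) (cell x v).

Definition rrepr (X : sspace) (p : realization X) : cells X :=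
  repr (p : {eq_quot (glue_equiv X)}).

(** The maps induced on realizations, computed on a representative; see
    [realize_mapE] and [realize_flipE] for independence of its choice. *)
Definition realize_map (X Y : sspace) (f : forall n, X n -> Y n)
    (p : realization X) : realization Y :=
  rpi (f _ (projT2 (rrepr p)).1) (projT2 (rrepr p)).2.

Definition realize_flip (X Y : sspace) (f : forall n, X n -> Y n)
    (p : realization X) : realization Y :=
  rpi (f _ (projT2 (rrepr p)).1) (simplex_rev (projT2 (rrepr p)).2).

Definition realize_prod (X Y : sspace) (z : realization (sprod X Y)) :
    kprod (realization X) (realization Y) :=
  (@realize_map (sprod X Y) X (fun n => fst) z,
   @realize_map (sprod X Y) Y (fun n => snd) z).

End Realization.

Lemma rpi_eq R (X : sspace) n m (x : X n) (v : simplex R n) (y : X m) w :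
  clos_refl_sym_trans _ (@glue_step R X) (cell x v) (cell y w) ->
  rpi x v = rpi y w.
Proof. by move=> h; apply/eqmodP/asboolP. Qed.

Lemma rrepr_rpi R (X : sspace) n (x : X n) (v : simplex R n) :
  clos_refl_sym_trans _ (@glue_step R X) (rrepr (rpi x v)) (cell x v).
Proof. by apply/asboolP/(@eqmodP _ (glue_equiv R X)); rewrite /rrepr reprK. Qed.

Lemma realize_mapE (R : realType) (X Y : sspace) (f : forall n, X n -> Y n) :
  simplicial_map f -> forall n (x : X n) (v : simplex R n),
  realize_map f (rpi x v) = rpi (f n x) v.
Proof.
move=> [fd fs] n x v; rewrite /realize_map; apply: rpi_eq.
pose g (c : cells R X) := cell (f _ (projT2 c).1) (projT2 c).2.
rewrite -[cell (f n x) v]/(g (cell x v)) -/(g _).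
elim: (rrepr_rpi x v) => [_ _ [m i y w|m i y w]|a|a b _|a b c _ + _].
- by apply: rst_step; rewrite /g /= fd; exact: glue_face.
- by apply: rst_step; rewrite /g /= fs; exact: glue_degen.
- exact: rst_refl.
- exact: rst_sym.
- exact: rst_trans.
Qed.

Lemma realize_flipE (R : realType) (X Y : sspace) (f : forall n, X n -> Y n) :
  antisimplicial_map f -> forall n (x : X n) (v : simplex R n),
  realize_flip f (rpi x v) = rpi (f n x) (simplex_rev v).
Proof.
move=> [fd fs] n x v; rewrite /realize_flip; apply: rpi_eq.
pose g (c : cells R X) := cell (f _ (projT2 c).1) (simplex_rev (projT2 c).2).
rewrite -[cell (f n x) _]/(g (cell x v)) -/(g _).
elim: (rrepr_rpi x v) => [_ _ [m i y w|m i y w]|a|a b _|a b c _ + _].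
- by apply: rst_step; rewrite /g /= fd coface_rev; exact: glue_face.
- by apply: rst_step; rewrite /g /= fs codegen_rev; exact: glue_degen.
- exact: rst_refl.
- exact: rst_sym.
- exact: rst_trans.
Qed.

(** Carrier and operations of a (possibly twisted) monoid with C2-action; the
    axioms are separate predicates, so that the bar constructions below are
    total and can be iterated.  They are meaningful on [c2_monoid]s and
    [twisted_monoid]s respectively. *)
Record c2magma := C2Magma {
  c2carrier :> topologicalType;
  c2mul : c2carrier -> c2carrier -> c2carrier;
  c2one : c2carrier;
  c2tau : c2carrier -> c2carrier }.

Arguments c2one {_}.
Arguments c2tau {_} _.

Record based_c2_space (A : c2magma) : Prop := {
  c2_kspace : kspace A;
  c2_tau_continuous : continuous (@c2tau A);
  c2_tauK : involutive (@c2tau A);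
  c2_tau_one : c2tau (@c2one A) = c2one }.

Record topological_monoid (A : c2magma) : Prop := {
  tm_continuous : continuous (fun p : kprod A A => c2mul p.1 p.2 : A);
  tm_assoc : associative (@c2mul A);
  tm_left_id : left_id c2one (@c2mul A);
  tm_right_id : right_id c2one (@c2mul A) }.

Record c2_monoid (A : c2magma) : Prop := {
  c2m_space : based_c2_space A;
  c2m_monoid : topological_monoid A;
  c2m_tau : forall x y : A, c2tau (c2mul x y) = c2mul (c2tau x) (c2tau y) }.

Record twisted_monoid (A : c2magma) : Prop := {
  twm_space : based_c2_space A;
  twm_monoid : topological_monoid A;
  twm_tau : forall x y : A, c2tau (c2mul x y) = c2mul (c2tau y) (c2tau x) }.

Record com_c2_monoid (A : c2magma) : Prop := {
  com_c2m : c2_monoid A;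
  com_mulC : commutative (@c2mul A) }.

Lemma com_c2_monoid_twisted (A : c2magma) :
  com_c2_monoid A -> twisted_monoid A.
Proof. by move=> [[sA mA tA] cA]; split => // x y; rewrite tA cA. Qed.

Record c2_monoid_morphism (A B : c2magma) (f : A -> B) : Prop := {
  mor_continuous : continuous f;
  mor_mul : {morph f : x y / c2mul x y};
  mor_one : f c2one = c2one;
  mor_tau : {morph f : x / c2tau x} }.

Definition c2_homeomorphism (A B : c2magma) (f : A -> B) : Prop :=
  homeomorphism f /\ {morph f : x / c2tau x}.

(** With 0-based coordinates, entry [j] of [d_i a] is [a_j] if [j + 1 < i],
    [a_j * a_(j+1)] if [j + 1 = i], and [a_(j+1)] if [i <= j]; in particular
    [d_0] and [d_(n+1)] drop the first and the last entry of an
    [(n+1)]-tuple. *)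
Definition nerve_face (A : c2magma) n (i : 'I_n.+2) (a : kpow A n.+1) :
    kpow A n :=
  fun j => let l := a (widen_ord (leqnSn n) j) in
           let r := a (lift ord0 j) in
           if (j.+1 < i)%N then l else if j.+1 == i :> nat then c2mul l r else r.

Definition nerve_degen (A : c2magma) n (i : 'I_n.+1) (a : kpow A n) :
    kpow A n.+1 :=
  fun j => if unlift i j is Some k then a k else c2one.

Definition nerve (A : c2magma) : sspace :=
  SSpace (@nerve_face A) (@nerve_degen A).

Definition nerve_mul (A : c2magma) n (p : sprod (nerve A) (nerve A) n) :
    nerve A n :=
  fun j => c2mul (p.1 j) (p.2 j).

Definition nerve_tau (A : c2magma) n (a : nerve A n) : nerve A n :=
  fun j => c2tau (a j).

Definition nerve_revtau (A : c2magma) n (a : nerve A n) : nerve A n :=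
  fun j => c2tau (a (rev_ord j)).

Definition nerve_map (A B : c2magma) (f : A -> B) n (a : nerve A n) :
    nerve B n :=
  fun j => f (a j).

Lemma nerve_map_simplicial (A B : c2magma) (f : A -> B) :
  {morph f : x y / c2mul x y} -> f c2one = c2one ->
  @simplicial_map (nerve A) (nerve B) (@nerve_map A B f).
Proof.
move=> fM f1; split=> n i a; apply: funext => j; rewrite /nerve_map /=.
  by rewrite /nerve_face; case: ifP => // _; case: ifP => // _; rewrite fM.
by rewrite /nerve_degen; case: unlift.
Qed.

Lemma nerve_tau_simplicial (A : c2magma) :
  c2_monoid A -> simplicial_map (@nerve_tau A).
Proof. by move=> [[_ _ _ t1] _ tM]; exact: nerve_map_simplicial. Qed.

Lemma nerve_revtau_antisimplicial (A : c2magma) :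
  twisted_monoid A -> antisimplicial_map (@nerve_revtau A).
Proof.
move=> [[_ _ _ t1] _ tM]; split=> n i a; apply: funext => j.
  rewrite /nerve_revtau /= /nerve_face /=.
  have -> : rev_ord (widen_ord (leqnSn n) j) = @lift n.+1 ord0 (rev_ord j).
    by apply: ord_inj; rewrite /= /bump /=; have := ltn_ord j; lia.
  have -> : rev_ord (@lift n.+1 ord0 j) = widen_ord (leqnSn n) (rev_ord j).
    by apply: ord_inj; rewrite /= /bump /=; have := ltn_ord j; lia.
  have := ltn_ord i; have := ltn_ord j => hj hi.
  by case: ltngtP => h1; case: ltngtP => h2; rewrite ?tM //; lia.
rewrite /nerve_revtau /= /nerve_degen.
case: unliftP => [k hk|hk].
  change 'I_n in k.
  have -> : j = @lift n.+1 (rev_ord i) (rev_ord k).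
    apply: (can_inj (@rev_ordK _)); rewrite hk; apply: ord_inj => /=.
    by rewrite /bump; have := ltn_ord i; have := ltn_ord k; lia.
  by rewrite (liftK (rev_ord i : 'I_n.+1)) rev_ordK.
by rewrite -hk rev_ordK unlift_none t1.
Qed.

Lemma nerve_mul_simplicial (A : c2magma) : associative (@c2mul A) ->
  commutative (@c2mul A) -> left_id c2one (@c2mul A) ->
  simplicial_map (@nerve_mul A).
Proof.
move=> mA mC m1; split=> n i a; apply: funext => j; rewrite /nerve_mul /=.
  rewrite /nerve_face; case: ifP => // _; case: ifP => // _.
  by rewrite -!mA; congr c2mul; rewrite !mA; congr c2mul; exact: mC.
by rewrite /nerve_degen; case: unlift => //=; rewrite m1.
Qed.

Section Bar.
Variables (R : realType) (A : c2magma).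

Definition bar_space : topologicalType := realization R (nerve A).

Definition bar_one : bar_space :=
  @rpi R (nerve A) 0 (fun _ => c2one) (vertex R).

Definition bar_square_one : realization R (sprod (nerve A) (nerve A)) :=
  @rpi R (sprod (nerve A) (nerve A)) 0 (fun _ => c2one, fun _ => c2one) (vertex R).

(** The product induced by levelwise multiplication: realize [nerve_mul] and
    precompose with the inverse of the canonical map [realize_prod].  The
    default value [bar_square_one] is never used when [realize_prod] is
    bijective. *)
Definition bar_mul (p q : bar_space) : bar_space :=
  realize_map (@nerve_mul A)
    (xget bar_square_one
       [set z | @realize_prod R (nerve A) (nerve A) z = (p, q)]).

Definition bar_mul_well_defined : Prop :=
  homeomorphism (@realize_prod R (nerve A) (nerve A)).

Lemma bar_mulE : bar_mul_well_defined ->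
  forall z : realization R (sprod (nerve A) (nerve A)),
  bar_mul (realize_prod z).1 (realize_prod z).2 = realize_map (@nerve_mul A) z.
Proof.
move=> [g [gK _ _ _]] z; rewrite /bar_mul; congr realize_map.
apply: (can_inj gK); rewrite [RHS]surjective_pairing.
by case: xgetP => [y _ //|/(_ z)]; case.
Qed.

Definition bar : c2magma :=
  C2Magma bar_mul bar_one (realize_map (@nerve_tau A)).

Definition tbar : c2magma :=
  C2Magma bar_mul bar_one (realize_flip (@nerve_revtau A)).

End Bar.

Definition bar_map (R : realType) (A B : c2magma) (f : A -> B) :
    bar R A -> bar R B :=
  realize_map (@nerve_map A B f).

Definition tbar_map (R : realType) (A B : c2magma) (f : A -> B) :
    tbar R A -> tbar R B :=
  realize_map (@nerve_map A B f).

Arguments bar_map R {A B} f _.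
Arguments tbar_map R {A B} f _.

(* Main.v *)
(** For [A] commutative, a point [(a, v)] of [BA] is a configuration of labels
    [a_j] at the positions [v_0 + ... + v_j] of the unit interval, where labels
    at the same position are multiplied and labels at [0] or [1] are forgotten.
    So [BA] is, as a set, the set of finitely supported functions [(0, 1) -> A]
    ([density] below), its product is pointwise multiplication, and all
    identities between points can be checked on densities.

    For continuity, unordered configurations [(a, s)], with [s] in [R^N], depend
    continuously on [a] and [s]: for each permutation [u] the locus where
    [s o u] is sorted is closed, and there the configuration is a cell of [BA]
    with continuous coordinates.  As products of quotient maps of k-spaces are
    quotient maps, the product of [BA] is therefore continuous, and the inverse
    of [|NA x NA| -> BA x BA] is [(p, q) |-> (p, 1) (1, q)], a product in
    [B(A x A)].

    Points of [BBA] are finitely supported functions [(0, 1)^2 -> A], and the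
    homeomorphism is [f(s, t) |-> f(t, s)], which exchanges the action
    [tau f(s, 1 - t)] with [tau f(1 - s, t)]. *)

Require Import Defs.
From HB Require Import structures.
From Stdlib Require Import Relation_Operators.
From mathcomp Require Import all_boot all_order all_algebra perm.
From mathcomp Require Import generic_quotient zify lra.
From mathcomp Require Import boolp classical_sets functions reals.
From mathcomp Require Import topology normedtype.

Set Implicit Arguments.
Unset Strict Implicit.
Unset Printing Implicit Defensive.

Import Order.TTheory GRing.Theory Num.Theory.
Import numFieldTopology.Exports.
Local Open Scope classical_set_scope.
Local Open Scope ring_scope.
Local Open Scope quotient_scope.

(** * Compactly generated spaces *)

Lemma kify_openE (T : topologicalType) (U : set T) :
  open (U : set (kify T)) = kopen U.
Proof. by []. Qed.

Lemma kify_id_continuous (T : topologicalType) :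
  continuous (id : kify T -> T).
Proof.
apply/continuousP => U oU; rewrite kify_openE => K u _ _ cu.
by move/continuousP: cu; apply.
Qed.

(** Universal property of k-ification: a test map into [X] followed by [f] is a test map into [T],
    so k-open sets of [T] pull back to k-open sets of [X]. *)
Lemma kify_continuous (X T : topologicalType) (f : X -> T) :
  kspace X -> continuous f -> continuous (f : X -> kify T).
Proof.
move=> kX cf; apply/continuousP => U; rewrite kify_openE => kU.
apply: kX => K u cK hK cu.
apply: (kU K (f \o u)) => // x; apply: continuous_comp; [exact: cu|exact: cf].
Qed.

Lemma compact_hausdorff_kspace (K : topologicalType) :
  compact [set: K] -> hausdorff_space K -> kspace K.
Proof. by move=> cK hK U /(_ K id cK hK); apply=> x. Qed.

Lemma kify_kspace (T : topologicalType) : kspace (kify T).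
Proof.
move=> U kU; rewrite kify_openE => K u cK hK cu.
by apply: (kU K) => //; apply: kify_continuous => //;
  exact: compact_hausdorff_kspace.
Qed.

Lemma kprod_fst_continuous (Y Z : topologicalType) :
  continuous (fst : kprod Y Z -> Y).
Proof.
move=> p; apply: (@continuous_comp _ _ _ (id : kprod Y Z -> Y * Z) fst).
  exact: kify_id_continuous.
exact: cvg_fst.
Qed.

Lemma kprod_snd_continuous (Y Z : topologicalType) :
  continuous (snd : kprod Y Z -> Z).
Proof.
move=> p; apply: (@continuous_comp _ _ _ (id : kprod Y Z -> Y * Z) snd).
  exact: kify_id_continuous.
exact: cvg_snd.
Qed.

Lemma kprod_pair_continuous (X Y Z : topologicalType) (f : X -> Y) (g : X -> Z)
  :
  kspace X -> continuous f -> continuous g ->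
  continuous (fun x => (f x, g x) : kprod Y Z).
Proof.
move=> kX cf cg; apply: kify_continuous => // x.
by apply: cvg_pair; [exact: cf | exact: cg].
Qed.

Lemma ptws_proj_continuous (I : eqType) (Y : topologicalType) (i : I) :
  continuous (fun a : {ptws I -> Y} => a i).
Proof. exact: (@proj_continuous I (fun _ => Y) i). Qed.

Lemma ptws_continuous (I : eqType) (X Y : topologicalType)
    (f : X -> {ptws I -> Y}) :
  (forall i, continuous (fun x => f x i)) -> continuous f.
Proof.
move=> cf x; apply/cvg_sup => i.
exact: (@continuous_comp_initial {ptws I -> Y} X Y (fun a => a i) f (cf i) x).
Qed.

Lemma kpow_proj_continuous (Y : topologicalType) n (i : 'I_n) :
  continuous (fun a : kpow Y n => a i).
Proof.
move=> a; apply: (@continuous_comp _ _ _ (id : kpow Y n -> {ptws 'I_n -> Y})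
  (fun a => a i)).
  exact: kify_id_continuous.
exact: ptws_proj_continuous.
Qed.

Lemma kpow_continuous (X Y : topologicalType) n (f : X -> kpow Y n) :
  kspace X -> (forall i, continuous (fun x => f x i)) -> continuous f.
Proof. by move=> kX cf; apply: kify_continuous => //;
  exact: ptws_continuous. Qed.

Lemma set_type_continuous (X Y : topologicalType) (D : set Y) (f : X -> D) :
  continuous (fun x => sval (f x)) -> continuous f.
Proof. by move=> cf; apply: (@continuous_comp_initial _ _ _ set_val). Qed.

(** The tube lemma, with compactness of [C] used as a near-covering property. *)
Lemma tube_open (L K : topologicalType) (U : set (L * K)) (C : set K) :
  compact C -> open U -> open [set l | forall c, C c -> U (l, c)].
Proof.
move=> /compact_near_coveringP cC oU; rewrite openE => l lU.
apply: (cC L (nbhs l) (fun l' c => U (l', c))) => c Cc.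
move: oU; rewrite openE => /(_ _ (lU c Cc)); rewrite /interior /=.
by case=> -[P Q] [/= nP nQ] PQ; exists (Q, P) => // -[k l'] [/= Qk Pl];
  apply: PQ.
Qed.

Lemma hausdorff_prod (K L : topologicalType) :
  hausdorff_space K -> hausdorff_space L -> hausdorff_space (K * L)%type.
Proof.
move=> hK hL [a b] [c d] cl; congr pair.
- apply: hK => P Q nP nQ.
  have [] := cl (P `*` setT) (Q `*` setT).
  + by exists (P, setT) => //; split => //; exact: filterT.
  + by exists (Q, setT) => //; split => //; exact: filterT.
  by move=> [x y] [/= [Px _] [Qx _]]; exists x.
- apply: hL => P Q nP nQ.
  have [] := cl (setT `*` P) (setT `*` Q).
  + by exists (setT, P) => //; split => //; exact: filterT.
  + by exists (setT, Q) => //; split => //; exact: filterT.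
  by move=> [x y] [/= [_ Py] [_ Qy]]; exists y.
Qed.

(** A quotient map out of the disjoint union of the [X i], kept as a family because a realization is
    glued from one space of cells in each dimension. *)
Definition jointly_quotient (I : Type) (X : I -> topologicalType)
    (Y : topologicalType) (q : forall i, X i -> Y) : Prop :=
  [/\ forall y, exists i, exists x, q i x = y,
      forall i, continuous (q i)
    & forall U, (forall i, open (q i @^-1` U)) -> open U].

Section JointlyQuotient.
Variables (I : Type) (X : I -> topologicalType) (Y : topologicalType).
Variable q : forall i, X i -> Y.
Arguments q : clear implicits.
Hypothesis kX : forall i, kspace (X i).
Hypothesis qY : jointly_quotient q.

Lemma jointly_quotient_kspace : kspace Y.
Proof.
case: qY => _ cq oq U kU; apply: oq => i; apply: kX => K u cK hK cu.
apply: (kU K (q i \o u)) => // x.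
by apply: continuous_comp; [exact: cu|exact: cq].
Qed.

Lemma jointly_quotient_continuous (Z : topologicalType) (f : Y -> Z) :
  (forall i, continuous (fun x => f (q i x))) -> continuous f.
Proof.
case: qY => _ _ oq cf; apply/continuousP => U oU; apply: oq => i.
by move/continuousP: (cf i); apply.
Qed.

(** If [W] has open preimages and the slice of [W] over [x0] contains a closed
    neighborhood [C] of a point of the test space, then the [y] with
    [{y} x C] contained in [W] form an open set, by the tube lemma applied on
    the test spaces of the [X i]. *)
Lemma jointly_quotient_kprod (Z : topologicalType) :
  jointly_quotient (fun i (p : kprod (X i) Z) => (q i p.1, p.2) : kprod Y Z).
Proof.
case: qY => sq cq oq; split.
- by move=> [y z]; have [i [x <-]] := sq y; exists i, (x, z).
- move=> i; apply: kprod_pair_continuous; first exact: kify_kspace.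
  + move=> p; apply: continuous_comp; first exact: kprod_fst_continuous.
    exact: cq.
  + exact: kprod_snd_continuous.
move=> W oW; rewrite kify_openE => K u cK hK cu; rewrite openE => k0 Wk0.
have cu1 : continuous (fun k => (u k).1) by move=> k; apply: cvg_comp;
  [exact: cu|exact: cvg_fst].
have cu2 : continuous (fun k => (u k).2) by move=> k; apply: cvg_comp;
  [exact: cu|exact: cvg_snd].
(* The product of the test spaces [L] and [K] is again compact Hausdorff, so it tests the preimage
   of [W] in [kprod (X i) Z]. *)
have oL i (L : topologicalType) (v : L -> X i) : compact [set: L] ->
    hausdorff_space L -> continuous v ->
    open [set p : L * K | W (q i (v p.1), (u p.2).2)].
  move=> cL hL cv; have := oW i; rewrite kify_openE.
  move=> /(_ _ (fun p : L * K => (v p.1, (u p.2).2))); apply.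
  - by rewrite -setXTT; apply: compact_setX.
  - exact: hausdorff_prod.
  - move=> p; apply: cvg_pair.
      by apply: (@continuous_comp _ _ _ fst v); [exact: cvg_fst|exact: cv].
    by apply: (@continuous_comp _ _ _ snd (fun k => (u k).2));
      [exact: cvg_snd|exact: cu2].
have [i0 [x0 qx0]] := sq (u k0).1.
pose S := [set k | W (q i0 x0, (u k).2)].
have oS : open S.
  have o2 := oL i0 K (fun=> x0) cK hK (@cst_continuous K (X i0) x0).
  have : continuous (fun k : K => (k, k)) by move=> k; apply: cvg_pair;
    exact: cvg_id.
  by move/continuousP => /(_ _ o2).
have Sk0 : S k0 by rewrite /S /= qx0 -surjective_pairing.
have [C nC CS] : filter_from (nbhs k0) closure S.
  apply: (compact_regular hK cK); first exact: filterT.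
  exact: open_nbhs_nbhs.
pose V := [set y | forall c, closure C c -> W (y, (u c).2)].
have oV : open V.
  apply: oq => i; apply: kX => L v cL hL cv.
  apply: (@tube_open L K [set p | W (q i (v p.1), (u p.2).2)]); last exact: oL.
  by apply: (subclosed_compact _ cK) => //; exact: closed_closure.
have : nbhs k0 ((fun k => (u k).1) @^-1` V `&` C).
  apply: filterI => //; apply: cu1; apply: open_nbhs_nbhs; split=> //.
  by move=> c /CS; rewrite /S /= qx0.
apply: filterS => k [Vk Ck] /=; rewrite [u k]surjective_pairing.
by apply: Vk; apply: subset_closure.
Qed.

End JointlyQuotient.

(** The pasting lemma: the preimage of a closed set is a finite union of closed pieces. Each [g i]
    is continuous on all of [X], which avoids subspace topologies. *)
Lemma closed_cover_continuous (X Y : topologicalType) (I : finType)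
    (D : I -> set X) (g : I -> X -> Y) (f : X -> Y) :
  (forall i, closed (D i)) -> (forall x, exists i, D i x) ->
  (forall i, continuous (g i)) -> (forall i x, D i x -> f x = g i x) ->
  continuous f.
Proof.
move=> cD covD cg fg; apply/continuous_closedP => F cF.
have -> : f @^-1` F = \big[setU/set0]_(i <- enum I) (D i `&` g i @^-1` F).
  apply/seteqP; split=> x /=; rewrite -bigcup_seq.
    by move=> Fx; have [i Di] := covD x; exists i; rewrite /= ?mem_enum // -fg.
  by move=> [i _ [Di Fi]]; rewrite (fg _ _ Di).
apply: closed_bigsetU => i _; apply: closedI => //.
by move/continuous_closedP: (cg i); apply.
Qed.

(** * Topology of realizations and of their induced maps *)

Section RealizationTopology.
Variable R : realType.

Lemma rpi_jointly_quotient (X : sspace) :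
  jointly_quotient (fun n (p : kprod (X n) (simplex R n)) => rpi p.1 p.2).
Proof.
split.
- move=> p; rewrite -[p]reprK; case: (repr _) => n [x v].
  by exists n, (x, v).
- move=> n; rewrite (_ : (fun p => _)
  = (\pi_(realization R X) : cells R X -> _) \o
      existT (fun n => kprod (X n) (simplex R n)) n); last first.
    by apply: funext => -[x v].
  move=> p; apply: continuous_comp; first exact: existT_continuous.
  exact: pi_continuous.
- move=> U oU; rewrite /open /= /quotient_open; apply/sigT_openP => n.
  have := oU n; congr open.
  by apply/seteqP; split=> -[x v].
Qed.

Lemma realization_kspace (X : sspace) : kspace (realization R X).
Proof.
apply: (jointly_quotient_kspace _ (rpi_jointly_quotient X)) => n.
exact: kify_kspace.
Qed.

Lemma rpi_surj (X : sspace) (p : realization R X) :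
  exists n (x : X n) (v : simplex R n), p = rpi x v.
Proof.
have [sq _ _] := rpi_jointly_quotient X.
by have [n [[x v] <-]] := sq p; exists n, x, v.
Qed.

Lemma realization_continuous (X : sspace) (Z : topologicalType)
    (f : realization R X -> Z) :
  (forall n, continuous (fun p : kprod (X n) (simplex R n) => f (rpi p.1 p.2)))
    ->
  continuous f.
Proof. exact: (jointly_quotient_continuous (rpi_jointly_quotient X)). Qed.

(** Taking the product with [Y] preserves the quotient map from the cells, so continuity can be
    tested on cells times [Y]. *)
Lemma realization_kprod_continuous (X : sspace) (Y Z : topologicalType)
    (f : kprod (realization R X) Y -> Z) :
  (forall n, continuous (fun p : kprod (kprod (X n) (simplex R n)) Y =>
     f (rpi p.1.1 p.1.2, p.2))) ->
  continuous f.
Proof.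
apply: (jointly_quotient_continuous
  (jointly_quotient_kprod _ (rpi_jointly_quotient X) Y)) => n.
exact: kify_kspace.
Qed.

Lemma rpi_continuous (X : sspace) n (W : topologicalType) (f : W -> X n)
    (g : W -> simplex R n) :
  kspace W -> continuous f -> continuous g -> continuous (fun w => rpi (f w)
    (g w)).
Proof.
move=> kW cf cg w; apply: (@continuous_comp _ _ _
  (fun w => (f w, g w) : kprod (X n) (simplex R n)) (fun p => rpi p.1 p.2)).
  exact: kprod_pair_continuous.
by case: (rpi_jointly_quotient X) => _ + _; apply.
Qed.

Lemma realize_map_continuous (X Y : sspace) (f : forall n, X n -> Y n) :
  simplicial_map f -> (forall n, continuous (f n)) ->
  continuous (@realize_map R X Y f).
Proof.
move=> sf cf; apply: realization_continuous => n.
rewrite (_ : (fun p => _) = fun p : kprod (X n) (simplex R n) => rpi (f n p.1)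
  p.2).
  apply: rpi_continuous; first exact: kify_kspace.
    move=> p; apply: continuous_comp; first exact: kprod_fst_continuous.
    exact: cf.
  exact: kprod_snd_continuous.
by apply: funext => p; rewrite realize_mapE.
Qed.

Lemma simplex_coord_continuous n (i : 'I_n.+1) :
  continuous (fun v : simplex R n => sval v i).
Proof.
move=> v; apply: (@continuous_comp _ _ _
  (set_val : simplex R n -> {ptws 'I_n.+1 -> R})
  (fun a => a i)).
  exact: initial_continuous.
exact: ptws_proj_continuous.
Qed.

Lemma simplex_continuous (X : topologicalType) n (f : X -> simplex R n) :
  (forall i, continuous (fun x => sval (f x) i)) -> continuous f.
Proof. by move=> cf; apply: set_type_continuous; apply: ptws_continuous. Qed.

Lemma simplex_rev_continuous n : continuous (@simplex_rev R n).
Proof. by apply: simplex_continuous => i; exact: simplex_coord_continuous. Qed.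

Lemma realize_flip_continuous (X Y : sspace) (f : forall n, X n -> Y n) :
  antisimplicial_map f -> (forall n, continuous (f n)) ->
  continuous (@realize_flip R X Y f).
Proof.
move=> sf cf; apply: realization_continuous => n.
rewrite (_ : (fun p => _) =
  fun p : kprod (X n) (simplex R n) => rpi (f n p.1) (simplex_rev p.2)).
  apply: rpi_continuous; first exact: kify_kspace.
    move=> p; apply: continuous_comp; first exact: kprod_fst_continuous.
    exact: cf.
  move=> p; apply: continuous_comp; first exact: kprod_snd_continuous.
  exact: simplex_rev_continuous.
by apply: funext => p; rewrite realize_flipE.
Qed.

End RealizationTopology.

(** * Configurations of labels in the unit interval *)

(** The argument [hA] is there for [cmul hA] to carry a [Monoid.com_law]. *)
Definition cmul (A : c2magma) (hA : com_c2_monoid A) : A -> A -> A := @c2mul A.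

Section CmulLaw.
Variables (A : c2magma) (hA : com_c2_monoid A).

Lemma cmulA : associative (cmul hA).
Proof. exact: (tm_assoc (c2m_monoid (com_c2m hA))). Qed.

Lemma cmulC : commutative (cmul hA).
Proof. exact: (com_mulC hA). Qed.

Lemma cmul1 : left_id c2one (cmul hA).
Proof. exact: (tm_left_id (c2m_monoid (com_c2m hA))). Qed.

HB.instance Definition _ :=
  Monoid.isComLaw.Build A c2one (cmul hA) cmulA cmulC cmul1.

End CmulLaw.

Section Positions.
Variable R : realType.

(** Partial sums of barycentric coordinates, which present the simplex as the space of nondecreasing
    sequences in [0, 1]. The index runs over all naturals so that successors need no casts. *)
Definition pos n (v : simplex R n) (k : nat) : R :=
  \sum_(i < n.+1 | (i <= k)%N) sval v i.

Lemma pos_ge n (v : simplex R n) k : (n <= k)%N -> pos v k = 1.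
Proof.
move=> nk; rewrite -(simplex_sum v); apply: eq_bigl => i.
by rewrite (leq_trans _ nk) // -ltnS.
Qed.

Lemma pos0 n (v : simplex R n) : pos v 0 = sval v ord0.
Proof. by rewrite /pos (big_pred1 ord0) // => i; rewrite /= leqn0. Qed.

Lemma posS n (v : simplex R n) (j : 'I_n) :
  pos v j.+1 = pos v j + sval v (lift ord0 j).
Proof.
rewrite /pos (bigD1 (lift ord0 j)) //= addrC; congr (_ + _).
by apply: eq_bigl => i; rewrite -val_eqE /= /bump; lia.
Qed.

Lemma pos_push m n (f : 'I_m.+1 -> 'I_n.+1) (v : simplex R m) k :
  pos (push f v) k = \sum_(i | (f i <= k)%N) sval v i.
Proof.
rewrite /pos [RHS](partition_big f (fun j => (j <= k)%N)) //=.
apply: eq_bigr => j jk; apply: eq_bigl => i.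
by case: eqP => [->|]; rewrite ?jk ?andbF.
Qed.

(** The first [j + 1] coordinates of the reversal are the last [j + 1] of [v], and all coordinates
    of [v] add up to 1. *)
Lemma simplex_rev_pos n (v : simplex R n) (j : 'I_n) :
  pos (simplex_rev v) j = 1 - pos v (rev_ord j).
Proof.
rewrite -(simplex_sum v) (bigID (fun i : 'I_n.+1 => (i <= rev_ord j)%N)) /=.
rewrite addrAC subrr add0r /pos (reindex_inj rev_ord_inj) /=.
apply: eq_big => [i|i _]; last by rewrite rev_ordK.
by have := ltn_ord i; have := ltn_ord j; lia.
Qed.

Lemma pos_inj n (v w : simplex R n) :
  (forall j : 'I_n, pos v j = pos w j) -> v = w.
Proof.
move=> vw.
have vw' k : pos v k = pos w k.
  have [kn|nk] := ltnP k n; first exact: (vw (Ordinal kn)).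
  by rewrite !pos_ge.
apply: simplex_eq => i; case: (unliftP ord0 i) => [j ->|->].
  by apply: (addrI (pos v j)); rewrite -posS vw' posS vw'.
by rewrite -!pos0 vw'.
Qed.

End Positions.

(** * The density of a point, and its invariance under gluing *)

Section Density.
Variables (R : realType) (A : c2magma).

Definition cell_density n (a : nerve A n) (v : simplex R n) (t : R) : A :=
  if 0 < t < 1 then \big[@c2mul A/c2one]_(j < n | pos v j == t) a j else c2one.

Definition density (p : bar_space R A) (t : R) : A :=
  cell_density (projT2 (rrepr p)).1 (projT2 (rrepr p)).2 t.

Hypothesis hA : com_c2_monoid A.

(** Both sides are products of the [a k]; the entry [k] sits at [pos v j] where
    [F j <= k < F j.+1], or at [0] or [1] when there is no such [j]. *)
Lemma cell_density_push m n (F : nat -> nat) (f : 'I_m.+1 -> 'I_n.+1)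
    (a : nerve A n) (b : nerve A m) (v : simplex R m) :
  {homo F : i j / (i <= j)%N} -> (forall i, f i = F i :> nat) ->
  (forall j : 'I_m, b j = \big[@c2mul A/c2one]_(k < n | (F j <= k < F j.+1)%N)
    a k) ->
  cell_density b v =1 cell_density a (push f v).
Proof.
rewrite -[@c2mul A]/(cmul hA) => mF fF bE t.
rewrite /cell_density -[@c2mul A]/(cmul hA); case: ifP => // /andP[t0 t1].
under eq_bigr do rewrite bE.
rewrite (exchange_big_dep xpredT) //= [RHS]big_mkcond; apply: eq_bigr => k _.
rewrite pos_push.
under [X in if X == t then _ else _]eq_bigl do rewrite fF.
have [kF0|F0k] := ltnP k (F 0%N).
  rewrite big_pred0 => [|j]; last first.
    by have := mF 0%N j isT; lia.
  rewrite big_pred0 ?(lt_eqF t0) // => i.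
  by have := mF 0%N i isT; lia.
have [Fmk|kFm] := leqP (F m) k.
  rewrite big_pred0 => [|j]; last first.
    by have := mF j.+1 m (ltn_ord j); lia.
  rewrite (eq_bigl xpredT) ?simplex_sum ?(gt_eqF t1) // => i.
  by have := mF i m (ltnSE (ltn_ord i)); lia.
have [j jm /andP[Fjk kFj]] : exists2 j, (j < m)%N & (F j <= k < F j.+1)%N.
  elim: (m) kFm => [|m' IH] kFm; first by lia.
  have [/IH[j jm' ?]|] := ltnP k (F m'); first by exists j => //; lia.
  by move=> Fm'; exists m' => //; rewrite Fm'.
have uniq_j i : (F i <= k < F i.+1)%N = (i == j).
  apply/idP/eqP => [/andP[Fi kFi]|->]; last by rewrite Fjk.
  by have := mF i.+1 j; have := mF j.+1 i; lia.
have -> : \sum_(i < m.+1 | (F i <= k)%N) sval v i = pos v j.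
  apply: eq_bigl => i; have := mF i j; have := mF j.+1 i; lia.
case: ifP => vj.
  rewrite (big_pred1 (Ordinal jm)) // => i /=.
  by rewrite uniq_j -val_eqE /=; case: (i =P j :> nat) => [->|];
    rewrite ?vj ?andbF.
rewrite big_pred0 // => i; rewrite uniq_j.
by case: (i =P j :> nat) => [->|]; rewrite ?vj ?andbF.
Qed.

(** This and [nerve_degenE] bring faces and degeneracies into the form of [cell_density_push]. The
    range of [k] has two elements where a face multiplies two entries, none where a degeneracy
    inserts the unit, and one elsewhere. *)
Lemma nerve_faceE n (i : 'I_n.+2) (a : nerve A n.+1) j :
  nerve_face i a j =
  \big[@c2mul A/c2one]_(k < n.+1 | (bump i j <= k < bump i j.+1)%N) a k.
Proof.
rewrite /nerve_face -[@c2mul A]/(cmul hA).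
have [ji|ij|ij] := ltngtP j.+1 i.
- rewrite (big_pred1 (widen_ord (leqnSn n) j)) // => k.
  by rewrite /= -val_eqE /= /bump; lia.
- rewrite (big_pred1 (lift ord0 j)) // => k.
  by rewrite /= -val_eqE /= /bump; lia.
- rewrite (bigD1 (widen_ord (leqnSn n) j)) /=; last by rewrite /bump; lia.
  rewrite (big_pred1 (lift ord0 j)) // => k.
  by rewrite /= -!val_eqE /= /bump; lia.
Qed.

Lemma nerve_degenE n (i : 'I_n.+1) (a : nerve A n) j :
  nerve_degen i a j =
  \big[@c2mul A/c2one]_(k < n | (unbump i j <= k < unbump i j.+1)%N) a k.
Proof.
rewrite /nerve_degen -[@c2mul A]/(cmul hA).
case: unliftP => [k ->|->].
  rewrite (big_pred1 k) // => l.
  by rewrite /= -val_eqE /= /bump /unbump; lia.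
by rewrite big_pred0 // => l; rewrite /unbump; lia.
Qed.

(** Each generator of the gluing relation preserves [cell_density], by [cell_density_push] with
    [bump i] for faces and [unbump i] for degeneracies. *)
Lemma density_rpi n (a : nerve A n) (v : simplex R n) :
  density (rpi a v) =1 cell_density a v.
Proof.
move=> t; rewrite /density.
pose g (c : cells R (nerve A)) := cell_density (projT2 c).1 (projT2 c).2 t.
rewrite -[RHS]/(g (cell a v)) -/(g _).
elim: (rrepr_rpi a v) => [_ _ [m i b w|m i b w]|//|//|x y z _ -> _ //].
- apply: (@cell_density_push _ _ (bump i)) => // [k l|j];
  first by rewrite /bump; lia.
  exact: nerve_faceE.
- apply: (@cell_density_push _ _ (unbump i)) => // [k l|k|j].
  + by rewrite /unbump; lia.
  + by rewrite inordK // /unbump /=; have := ltn_ord i;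
    have := ltn_ord k => /=; lia.
  + exact: nerve_degenE.
Qed.

End Density.

(** * Normal forms, and the injectivity of the density *)

Section NormalForm.
Variables (R : realType) (A : c2magma).

(** A nondegenerate simplex together with an interior point of the standard simplex. *)
Definition normal_cell n (a : nerve A n) (v : simplex R n) : Prop :=
  (forall i, 0 < sval v i) /\ (forall j, a j != c2one).

Lemma rpi_face n (i : 'I_n.+2) (a : nerve A n.+1) (v : simplex R n) :
  rpi a (coface i v) = rpi (face i a) v.
Proof. by apply: rpi_eq; apply: rst_sym; apply: rst_step; exact: glue_face. Qed.

Lemma rpi_degen n (i : 'I_n.+1) (a : nerve A n) (v : simplex R n.+1) :
  rpi (degen i a : nerve A n.+1) v = rpi a (codegen i v).
Proof. by apply: rpi_eq; apply: rst_step; exact: glue_degen. Qed.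

Lemma simplex_zero_coface n (v : simplex R n.+1) i :
  sval v i = 0 -> exists w, v = coface i w.
Proof.
move=> vi0.
have wP : (fun k => sval v (lift i k)) \in simplex_set R n.
  apply: simplexP => [k|]; first exact: simplex_ge0.
  by rewrite -(simplex_sum v) (bigD1_ord i) //= vi0 add0r.
exists (exist (fun u => u \in simplex_set R n) _ wP);
  apply: simplex_eq => k /=; rewrite /push_fun.
case: (unliftP i k) => [l ->|->].
  by rewrite (big_pred1 l) // => m; rewrite /= (inj_eq lift_inj).
by rewrite big_pred0 // => m; rewrite eq_sym (negbTE (neq_lift _ _)).
Qed.

Lemma nerve_one_degen n (a : nerve A n.+1) j :
  a j = c2one -> exists b : nerve A n, a = degen j b.
Proof.
move=> aj1; exists (fun k => a (lift j k)); apply: funext => k /=.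
by rewrite /nerve_degen; case: unliftP => [l ->|->].
Qed.

(** By induction on the dimension: a zero coordinate makes [v] a coface, a trivial label makes [a] a
    degeneracy, and either allows passing to a cell of lower dimension. *)
Lemma rpi_normal n (a : nerve A n) (v : simplex R n) :
  exists m (b : nerve A m) (w : simplex R m),
    normal_cell b w /\ rpi a v = rpi b w.
Proof.
elim: n a v => [|n IH] a v.
  exists 0%N, a, v; split=> //; split=> [i|[]//].
  by have := simplex_sum v; rewrite big_ord1 (ord1 i) => ->; exact: ltr01.
have [/existsP[i /eqP/simplex_zero_coface[w ->]]|] :=
    boolP [exists i, sval v i == 0].
  by rewrite rpi_face; exact: IH.
rewrite negb_exists => /forallP v0.
have [/existsP[j /eqP/nerve_one_degen[b ->]]|] :=
  boolP [exists j, a j == c2one].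
  by rewrite rpi_degen; exact: IH.
rewrite negb_exists => /forallP a1.
exists n.+1, a, v; split=> //; split=> // i.
by rewrite lt_neqAle eq_sym v0 simplex_ge0.
Qed.

Lemma normal_pos_lt n (a : nerve A n) (v : simplex R n) :
  normal_cell a v -> forall k l, (k < l <= n)%N -> pos v k < pos v l.
Proof.
move=> [v0 _] k; elim=> [|l IH] // /andP[kl ln].
apply: (@le_lt_trans _ _ (pos v l)); last first.
  by rewrite (posS v (Ordinal ln)) ltrDl.
move: kl; rewrite ltnS leq_eqVlt => /predU1P[->//|kl].
by apply/ltW/IH; rewrite kl ltnW.
Qed.

Lemma normal_pos01 n (a : nerve A n) (v : simplex R n) :
  normal_cell a v -> forall j : 'I_n, 0 < pos v j < 1.
Proof.
move=> nv j; apply/andP; split.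
  apply: (@lt_le_trans _ _ (pos v 0)); first by rewrite pos0 nv.1.
  have [->//|j0] := posnP j.
  by apply/ltW/(normal_pos_lt nv); rewrite j0 ltnW.
by rewrite -(pos_ge v (leqnn n)); apply: (normal_pos_lt nv);
  rewrite ltn_ord leqnn.
Qed.

Lemma normal_density n (a : nerve A n) (v : simplex R n) :
  com_c2_monoid A -> normal_cell a v ->
  forall j : 'I_n, cell_density a v (pos v j) = a j.
Proof.
move=> hA nv j; rewrite /cell_density -[@c2mul A]/(cmul hA) (normal_pos01 nv).
rewrite (big_pred1 j) // => i /=; rewrite -val_eqE.
have [ij|ji|->] := ltngtP i j; last by rewrite eqxx.
  by rewrite lt_eqF //; apply: (normal_pos_lt nv); rewrite ij ltnW.
by rewrite gt_eqF //; apply: (normal_pos_lt nv); rewrite ji ltnW.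
Qed.

Lemma normal_support n (a : nerve A n) (v : simplex R n) :
  com_c2_monoid A -> normal_cell a v ->
  mkseq (pos v) n =i [pred t | cell_density a v t != c2one].
Proof.
move=> hA nv t; rewrite inE; apply/mapP/idP => [[j]|].
  rewrite mem_iota /= add0n => jn ->.
  by rewrite (normal_density hA nv (Ordinal jn)) nv.2.
apply: contraNP => nt; rewrite /cell_density; case: ifP => // _.
rewrite big_pred0 // => j; apply/negP => /eqP tj; apply: nt.
by exists (j : nat) => //; rewrite mem_iota /= add0n.
Qed.

(** The positions of a normal cell form the strictly increasing list of the support of its density.
    The density thus determines the dimension and the positions, and its values there are the
    labels. *)
Lemma normal_inj n m (a : nerve A n) (v : simplex R n) (b : nerve A m)
    (w : simplex R m) :
  com_c2_monoid A -> normal_cell a v -> normal_cell b w ->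
  cell_density a v =1 cell_density b w -> rpi a v = rpi b w.
Proof.
move=> hA nv nw vw.
have sorted_pos k (c : nerve A k) (u : simplex R k) : normal_cell c u ->
    sorted <%R (mkseq (pos u) k).
  move=> nu; apply: (homo_sorted_in _ _ (iota_ltn_sorted 0 k)).
    2: by apply/allP => i; exact: id.
  move=> i j; rewrite !mem_iota /= => _ jk ij.
  by apply: (normal_pos_lt nu); rewrite ij ltnW.
have e : mkseq (pos v) n = mkseq (pos w) m.
  apply: lt_sorted_eq; [exact: sorted_pos nv|exact: sorted_pos nw|move=> t].
  by rewrite (normal_support hA nv) (normal_support hA nw) !inE vw.
have nm : n = m by rewrite -(size_mkseq (pos v) n) e size_mkseq.
move: b w nw vw e; rewrite -nm => b w nw vw e.
have pe (j : 'I_n) : pos v j = pos w j.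
  by rewrite -(nth_mkseq 0 (pos v) (ltn_ord j)) e nth_mkseq.
have -> : a = b.
  apply: funext => j.
  by rewrite -(normal_density hA nv) vw pe (normal_density hA nw).
by congr rpi; exact: pos_inj.
Qed.

Lemma density_inj (p q : bar_space R A) : com_c2_monoid A ->
  density p =1 density q -> p = q.
Proof.
move=> hA; have [n [a [v ->]]] := rpi_surj p; have [m [b [w ->]]] := rpi_surj q.
have [n' [a' [v' [nv ->]]]] := rpi_normal a v.
have [m' [b' [w' [nw ->]]]] := rpi_normal b w => vw.
by apply: normal_inj => // t; rewrite -!density_rpi.
Qed.

Lemma density_one : com_c2_monoid A -> density (bar_one R A) =1 fun=> c2one.
Proof.
move=> hA t; rewrite /bar_one (density_rpi hA) /cell_density big_ord0.
by case: ifP.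
Qed.

End NormalForm.

(** * Unordered configurations *)

Section RealFunctions.
Variables (R : realType) (X : topologicalType).
Implicit Types f g : X -> R.

Lemma continuous_realB f g :
  continuous f -> continuous g -> continuous (fun x => f x - g x).
Proof. by move=> cf cg x; apply: (@cvgB _ R^o); [exact: cf|exact: cg]. Qed.

Lemma closed_le_fun f g :
  continuous f -> continuous g -> closed [set x | f x <= g x].
Proof.
move=> cf cg; rewrite (_ : [set x | _] = (fun x => g x - f x)
  @^-1` [set y | 0 <= y]).
  by apply: (continuous_closedP _).1;
    [exact: continuous_realB|exact: closed_ge].
by apply/seteqP; split=> x /=; rewrite subr_ge0.
Qed.

Lemma pos_continuous n (v : X -> simplex R n) k :
  continuous v -> continuous (fun x => pos (v x) k).
Proof.
move=> cv; apply: continuous_big => [x|i _ x]; first by apply: (@cvgD _ R^o);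
  [exact: cvg_fst|exact: cvg_snd].
by apply: (@continuous_comp _ _ _ v (fun w => sval w i));
  [exact: cv|exact: simplex_coord_continuous].
Qed.

End RealFunctions.

(** * Real sequences as points of the simplex *)

Section Spread.
Variable R : realType.

(** On all of ['I_N -> R], a continuous retraction to the nondecreasing
    sequences in [[0, 1]], shifted by one; the default value [1] makes it [1] at
    [k = N.+1]. *)
Fixpoint running_max N (s : 'I_N -> R) (k : nat) : R :=
  if k is k'.+1 then
    Num.max (running_max s k') (Num.min (odflt 1 (omap s (insub k'))) 1)
  else 0.

Lemma running_max_le1 N (s : 'I_N -> R) k : running_max s k <= 1.
Proof. by elim: k => [|k IH] /=;
  rewrite ?ler01 // ge_max IH ge_min lexx orbT. Qed.

Lemma running_max_last N (s : 'I_N -> R) : running_max s N.+1 = 1.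
Proof.
apply/le_anti; rewrite running_max_le1 /= le_max.
by rewrite insubF ?ltnn //= minxx lexx orbT.
Qed.

Lemma spread_subproof N (s : 'I_N -> R) :
  (fun k : 'I_N.+1 => running_max s k.+1 - running_max s k) \in simplex_set R N.
Proof.
apply: simplexP => [k|]; first by rewrite subr_ge0 /= le_max lexx.
rewrite -(big_mkord xpredT (fun k => running_max s k.+1 - running_max s k)).
by rewrite telescope_sumr // running_max_last subr0.
Qed.

Definition spread N (s : 'I_N -> R) : simplex R N :=
  exist (fun u => u \in simplex_set R N) _ (spread_subproof s).

Lemma pos_spread N (s : 'I_N -> R) (k : nat) :
  (k <= N)%N -> pos (spread s) k = running_max s k.+1.
Proof.
elim: k => [_|k IH kN]; first by rewrite pos0 /= subr0.
by rewrite (posS _ (Ordinal kN)) IH ?(ltnW kN) //= addrC subrK.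
Qed.

Definition nondecr N (s : 'I_N -> R) : Prop :=
  forall i j : 'I_N, (i <= j)%N -> s i <= s j.

(** For nondecreasing [s], the position of entry [j] is [s j] clamped to [0, 1]. Clamping alters
    only values outside the interval, and sends them to the endpoints, where labels are
    forgotten. *)
Lemma pos_spread_nondecr N (s : 'I_N -> R) (t : R) (j : 'I_N) :
  nondecr s -> 0 < t < 1 -> (pos (spread s) j == t) = (s j == t).
Proof.
move=> ms t01; rewrite pos_spread; last exact: ltnW.
suff -> : running_max s j.+1 = Num.max 0 (Num.min (s j) 1).
  rewrite /Num.min; case: ltP => ?; rewrite /Num.max; case: ltP => ?;
    apply/eqP/eqP; lra.
case: j => j /=; elim: j => [|j IH] jN /=.
  by rewrite insubT.
have {}IH := IH (ltnW jN); rewrite /= in IH; rewrite IH insubT /=.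
have := ms (Ordinal (ltnW jN)) (Ordinal jN) (leqnSn j).
set x := s _; set y := s _ => xy.
rewrite -maxA; congr Num.max; apply/max_idPr.
by rewrite le_min !ge_min xy lexx orbT.
Qed.

Lemma spread_continuous (X : topologicalType) N (s : X -> 'I_N -> R) :
  (forall i, continuous (fun x => s x i)) -> continuous (fun x => spread (s x)).
Proof.
move=> cs; apply: simplex_continuous => i /=.
have cM k : continuous (fun x => running_max (s x) k).
  elim: k => [|k IH] /=; first exact: cst_continuous.
  pose f x := odflt 1 (omap (s x) (insub k)).
  have cf : continuous f.
    by rewrite /f; case: insubP => [j _ _|_] /=;
      [exact: cs|exact: cst_continuous].
  have cm : continuous (fun x => Num.min (f x) 1).
    by move=> x; apply: (@continuous_min _ X f (fun=> 1));
      [exact: cf|exact: cst_continuous].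
  by move=> x; apply: (@continuous_max _ X (fun x => running_max (s x) k)
    (fun x => Num.min (f x) 1)); [exact: IH|exact: cm].
by apply: continuous_realB; [exact: (cM i.+1)|exact: cM].
Qed.

Lemma sorting_perm N (s : 'I_N -> R) : exists u : 'S_N, nondecr (s \o u).
Proof.
case: N s => [|N] s; first by exists 1%g => -[].
pose l := sort (relpre s <=%R) (enum 'I_N.+1).
have szl : size l = N.+1 by rewrite size_sort size_enum_ord.
have fI : injective (fun i : 'I_N.+1 => nth ord0 l i).
  move=> i j /eqP; rewrite nth_uniq ?szl ?ltn_ord ?sort_uniq ?enum_uniq //.
  by move=> /eqP /val_inj.
exists (perm fI) => i j ij /=; rewrite !permE.
have tr : transitive (relpre s <=%R) by move=> y x z; exact: le_trans.
apply: (@sorted_leq_nth _ (relpre s <=%R)) => //.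
- by move=> x; exact: lexx.
- by apply: sort_sorted => x y; exact: le_total.
- by rewrite inE szl.
- by rewrite inE szl.
Qed.

End Spread.

Section Configurations.
Variables (R : realType) (A : c2magma) (hA : com_c2_monoid A).

Lemma density_spread N (a : 'I_N -> A) (s : 'I_N -> R) (t : R) : nondecr s ->
  density (rpi (a : nerve A N) (spread s)) t =
  if 0 < t < 1 then \big[@c2mul A/c2one]_(i < N | s i == t) a i else c2one.
Proof.
move=> ms; rewrite (density_rpi hA) /cell_density; case: ifP => // t01.
by apply: eq_bigl => i; exact: pos_spread_nondecr.
Qed.

(** The sorting permutation is an arbitrary choice; by [density_conf] the resulting point does not
    depend on it. *)
Definition conf N (a : 'I_N -> A) (s : 'I_N -> R) : bar_space R A :=
  let u := sval (cid (sorting_perm s)) in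
  rpi (a \o u : nerve A N) (spread (s \o u)).

Lemma density_perm N (a : 'I_N -> A) (s : 'I_N -> R) (u : 'S_N) (t : R) :
  nondecr (s \o u) ->
  density (rpi (a \o u : nerve A N) (spread (s \o u))) t =
  if 0 < t < 1 then \big[@c2mul A/c2one]_(i < N | s i == t) a i else c2one.
Proof.
move=> /density_spread ->; case: ifP => // _; rewrite -[@c2mul A]/(cmul hA).
by rewrite [RHS](reindex_inj (@perm_inj _ u)).
Qed.

Lemma density_conf N (a : 'I_N -> A) (s : 'I_N -> R) (t : R) :
  density (conf a s) t =
  if 0 < t < 1 then \big[@c2mul A/c2one]_(i < N | s i == t) a i else c2one.
Proof. by rewrite /conf; case: cid => u /= ms; exact: density_perm. Qed.

Lemma conf_continuous (X : topologicalType) N (a : X -> 'I_N -> A)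
    (s : X -> 'I_N -> R) : kspace X ->
  (forall i, continuous (fun x => a x i)) ->
  (forall i, continuous (fun x => s x i)) ->
  continuous (fun x => conf (a x) (s x)).
Proof.
move=> kX ca cs.
apply: (@closed_cover_continuous _ _ 'S_N
  (fun u => [set x | nondecr (s x \o u)])
  (fun u x => rpi (a x \o u : nerve A N) (spread (s x \o u)))).
- move=> u; rewrite (_ : [set x | _] = \bigcap_(ij in [set ij : 'I_N * 'I_N |
      (ij.1 <= ij.2)%N]) [set x | s x (u ij.1) <= s x (u ij.2)]).
    by apply: closed_bigI => ij _; exact: closed_le_fun.
  apply/seteqP; split=> x /= h; first by move=> [i j] /=; exact: h.
  by move=> i j ij; exact: (h (i, j)).
- by move=> x; exact: sorting_perm.
- move=> u; apply: rpi_continuous => //.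
    by apply: kpow_continuous => // i; exact: ca.
  by apply: spread_continuous => i; exact: cs.
(* The permutation chosen by [conf] may differ from [u], but any two sorting permutations give the
   same density. *)
- move=> u x ms; apply: density_inj => // t.
  by rewrite density_conf density_perm.
Qed.

End Configurations.

(** * The product of the bar construction *)

Section BarProduct.
Variables (R : realType) (A : c2magma) (hA : com_c2_monoid A).

Definition cat_fun T m n (f : 'I_m -> T) (g : 'I_n -> T) (i : 'I_(m + n)) : T :=
  match fintype.split i with inl j => f j | inr k => g k end.

Lemma cat_funl T m n (f : 'I_m -> T) (g : 'I_n -> T) i :
  cat_fun f g (lshift n i) = f i.
Proof. by rewrite /cat_fun (unsplitK (inl i)). Qed.

Lemma cat_funr T m n (f : 'I_m -> T) (g : 'I_n -> T) i :
  cat_fun f g (rshift m i) = g i.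
Proof. by rewrite /cat_fun (unsplitK (inr i)). Qed.

Lemma density_conf_cat m n (a : nerve A m) (v : simplex R m)
    (b : nerve A n) (w : simplex R n) t :
  density (conf (cat_fun a b)
    (cat_fun (fun i : 'I_m => pos v i) (fun i : 'I_n => pos w i))) t =
  c2mul (density (rpi a v) t) (density (rpi b w) t).
Proof.
rewrite (density_conf hA) !(density_rpi hA) /cell_density.
rewrite -[@c2mul A]/(cmul hA); case: ifP => _; last by rewrite Monoid.mul1m.
rewrite big_split_ord; congr (cmul hA _ _); apply: eq_big => i;
  by rewrite ?cat_funl ?cat_funr.
Qed.

Lemma bmul_ex (p q : bar_space R A) :
  exists r : bar_space R A, forall t, density r t = c2mul (density p t)
    (density q t).
Proof.
have [m [a [v ->]]] := rpi_surj p; have [n [b [w ->]]] := rpi_surj q.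
by eexists => t; exact: density_conf_cat.
Qed.

(** The pointwise product of densities, realized by the union of two configurations. It is
    introduced apart from [bar_mul] because it serves to construct the inverse of [realize_prod] on
    which [bar_mul] rests. *)
Definition bmul (p q : bar_space R A) : bar_space R A :=
  sval (cid (bmul_ex p q)).

Lemma density_bmul p q t :
  density (bmul p q) t = c2mul (density p t) (density q t).
Proof. by rewrite /bmul; case: cid. Qed.

Lemma bmul_rpi m n (a : nerve A m) (v : simplex R m)
    (b : nerve A n) (w : simplex R n) :
  bmul (rpi a v) (rpi b w) = conf (cat_fun a b)
    (cat_fun (fun i : 'I_m => pos v i) (fun i : 'I_n => pos w i)).
Proof.
by apply: density_inj => // t; rewrite density_bmul density_conf_cat.
Qed.

(** Continuity is tested on cells of one factor at a time. On a pair of cells the product is a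
    [conf] whose labels and positions vary continuously. *)
Lemma bmul_continuous :
  continuous (fun p : kprod (bar_space R A) (bar_space R A) => bmul p.1 p.2).
Proof.
apply: realization_kprod_continuous => m.
pose Cm := kprod (nerve A m) (simplex R m).
have cg : continuous (fun p : kprod (bar_space R A) Cm =>
  bmul (rpi p.2.1 p.2.2) p.1).
  apply: realization_kprod_continuous => n.
  under eq_fun do rewrite bmul_rpi.
  pose Cn := kprod (nerve A n) (simplex R n).
  have c1 : continuous (fun p : kprod Cn Cm => p.1)
    by exact: kprod_fst_continuous.
  have c2 : continuous (fun p : kprod Cn Cm => p.2)
    by exact: kprod_snd_continuous.
  apply: conf_continuous => // [|i|i]; first exact: kify_kspace.
  - rewrite /cat_fun; case: fintype.split => j p.
      apply: (@continuous_comp _ _ _ (fun p : kprod Cn Cm => p.2)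
        (fun c : Cm => c.1 j)).
        exact: c2.
      apply: (@continuous_comp _ _ _ (fst : Cm -> kpow A m) (fun a => a j)).
        exact: kprod_fst_continuous.
      exact: kpow_proj_continuous.
    apply: (@continuous_comp _ _ _ (fun p : kprod Cn Cm => p.1)
      (fun c : Cn => c.1 j)).
      exact: c1.
    apply: (@continuous_comp _ _ _ (fst : Cn -> kpow A n) (fun a => a j)).
      exact: kprod_fst_continuous.
    exact: kpow_proj_continuous.
  - rewrite /cat_fun; case: fintype.split => j; apply: pos_continuous => p.
      apply: (@continuous_comp _ _ _ (fun p : kprod Cn Cm => p.2)
        (fun c : Cm => c.2)).
        exact: c2.
      exact: kprod_snd_continuous.
    apply: (@continuous_comp _ _ _ (fun p : kprod Cn Cm => p.1)
      (fun c : Cn => c.2)).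
      exact: c1.
    exact: kprod_snd_continuous.
(* The factors are exchanged because [realization_kprod_continuous] resolves only the first one. *)
move=> p; apply: (@continuous_comp _ _ _
  (fun p : kprod Cm (bar_space R A) => (p.2, p.1) : kprod (bar_space R A) Cm)
    _ p _ (cg _)).
apply: kprod_pair_continuous; first exact: kify_kspace.
- exact: kprod_snd_continuous.
- exact: kprod_fst_continuous.
Qed.

End BarProduct.

(** * Products of commutative monoids *)

Section ProductMonoid.
Variables A B : c2magma.

Definition c2prod : c2magma :=
  @C2Magma (kprod A B) (fun x y => (c2mul x.1 y.1, c2mul x.2 y.2))
    (c2one, c2one) (fun x => (c2tau x.1, c2tau x.2)).

Hypotheses (hA : com_c2_monoid A) (hB : com_c2_monoid B).

Lemma c2prod_com : com_c2_monoid c2prod.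
Proof.
case: hA => -[[kA ctA tKA t1A] [cmA aA lA rA] tmA] mCA.
case: hB => -[[kB ctB tKB t1B] [cmB aB lB rB] tmB] mCB.
have cf := @kprod_fst_continuous A B; have cs := @kprod_snd_continuous A B.
have mf : continuous (fun p : kprod c2prod c2prod => c2mul p.1.1 p.2.1 : A).
  move=> p; apply: (@continuous_comp _ _ _
    (fun p : kprod c2prod c2prod => (p.1.1, p.2.1) : kprod A A)
      (fun p => c2mul p.1 p.2)
    p _ (cmA _)).
  apply: kprod_pair_continuous; first exact: kify_kspace.
  - move=> q; apply: (@continuous_comp _ _ _
    (fst : kprod c2prod c2prod -> c2prod) fst q _ (cf _)).
    exact: kprod_fst_continuous.
  - move=> q; apply: (@continuous_comp _ _ _
    (snd : kprod c2prod c2prod -> c2prod) fst q _ (cf _)).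
    exact: kprod_snd_continuous.
have ms : continuous (fun p : kprod c2prod c2prod => c2mul p.1.2 p.2.2 : B).
  move=> p; apply: (@continuous_comp _ _ _
    (fun p : kprod c2prod c2prod => (p.1.2, p.2.2) : kprod B B)
      (fun p => c2mul p.1 p.2)
    p _ (cmB _)).
  apply: kprod_pair_continuous; first exact: kify_kspace.
  - move=> q; apply: (@continuous_comp _ _ _
    (fst : kprod c2prod c2prod -> c2prod) snd q _ (cs _)).
    exact: kprod_fst_continuous.
  - move=> q; apply: (@continuous_comp _ _ _
    (snd : kprod c2prod c2prod -> c2prod) snd q _ (cs _)).
    exact: kprod_snd_continuous.
split; [split; [split|split|]|].
- exact: kify_kspace.
- apply: kprod_pair_continuous; first exact: kify_kspace.
    by move=> p; exact: (@continuous_comp _ _ _ (fst : kprod A B -> A)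
      (@c2tau A) p (cf _) (ctA _)).
  by move=> p; exact: (@continuous_comp _ _ _ (snd : kprod A B -> B) (@c2tau B)
    p (cs _) (ctB _)).
- by move=> [x y] /=; rewrite tKA tKB.
- by rewrite /= t1A t1B.
- by apply: kprod_pair_continuous => //; exact: kify_kspace.
- by move=> x y z /=; rewrite aA aB.
- by move=> [x y] /=; rewrite lA lB.
- by move=> [x y] /=; rewrite rA rB.
- by move=> x y /=; rewrite tmA tmB.
- by move=> x y /=; rewrite mCA mCB.
Qed.

End ProductMonoid.

Section DensityMaps.
Variable R : realType.

Lemma density_nerve_map (A B : c2magma) (f : A -> B) (p : bar_space R A) t :
  com_c2_monoid A -> com_c2_monoid B ->
  {morph f : x y / c2mul x y} -> f c2one = c2one ->
  density (realize_map (@nerve_map A B f) p : bar_space R B)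
    t = f (density p t).
Proof.
move=> hA hB fM f1; have [n [a [v ->]]] := rpi_surj p.
rewrite (realize_mapE (nerve_map_simplicial fM f1)) (density_rpi hA)
  (density_rpi hB).
by rewrite /cell_density; case: ifP => // _; rewrite (big_morph f fM f1).
Qed.

Lemma nerve_map_continuous (A B : c2magma) (f : A -> B) n :
  continuous f -> continuous (@nerve_map A B f n).
Proof.
move=> cf; apply: kpow_continuous => [|i a]; first exact: kify_kspace.
apply: (@continuous_comp _ _ _ (fun a : kpow A n => a i) f); last exact: cf.
exact: kpow_proj_continuous.
Qed.

Lemma realize_nerve_map_continuous (A B : c2magma) (f : A -> B) :
  {morph f : x y / c2mul x y} -> f c2one = c2one -> continuous f ->
  continuous (realize_map (@nerve_map A B f) : bar_space R A -> bar_space R B).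
Proof.
move=> fM f1 cf; apply: realize_map_continuous;
  first exact: nerve_map_simplicial.
by move=> n; exact: nerve_map_continuous.
Qed.

End DensityMaps.

(** * Realization commutes with the product of two nerves *)

Section RealizeProd.
Variables (R : realType) (A : c2magma) (hA : com_c2_monoid A).
Let AA := c2prod A A.
Let NN := sprod (nerve A) (nerve A).
Let hAA : com_c2_monoid AA := c2prod_com hA hA.

(** [nerve_zip] and [nerve_unzip] identify [NN] with the nerve of [AA], where densities are
    available. *)
Definition nerve_zip n (p : NN n) : nerve AA n := fun j => (p.1 j, p.2 j).
Definition nerve_unzip n (a : nerve AA n) : NN n :=
  (fun j => (a j).1, fun j => (a j).2).

Lemma nerve_zip_simplicial : simplicial_map nerve_zip.
Proof.
split=> n i a; apply: funext => j; rewrite /nerve_zip /=.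
  by rewrite /nerve_face; case: ifP => // _; case: ifP.
by rewrite /nerve_degen; case: unlift.
Qed.

Lemma nerve_unzip_simplicial : simplicial_map nerve_unzip.
Proof.
split=> n i a; congr pair; apply: funext => j /=.
- by rewrite /nerve_face; case: ifP => // _; case: ifP.
- by rewrite /nerve_face; case: ifP => // _; case: ifP.
- by rewrite /nerve_degen; case: unlift.
- by rewrite /nerve_degen; case: unlift.
Qed.

Lemma nerve_unzip_continuous n : continuous (@nerve_unzip n).
Proof.
apply: kprod_pair_continuous; first exact: kify_kspace.
- exact: (@nerve_map_continuous AA A fst n (@kprod_fst_continuous A A)).
- exact: (@nerve_map_continuous AA A snd n (@kprod_snd_continuous A A)).
Qed.

Lemma fst_simplicial (X Y : sspace) :
  @simplicial_map (sprod X Y) X (fun n => fst).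
Proof. by []. Qed.

Lemma snd_simplicial (X Y : sspace) :
  @simplicial_map (sprod X Y) Y (fun n => snd).
Proof. by []. Qed.

Definition pair_bar (p q : bar_space R A) : bar_space R AA :=
  bmul hAA (realize_map (@nerve_map A AA (fun a => (a, c2one))) p)
           (realize_map (@nerve_map A AA (fun a => (c2one, a))) q).

Let one2 : c2mul c2one c2one = c2one :> A := cmul1 hA c2one.

Lemma density_pair_bar p q t :
  density (pair_bar p q) t = (density p t, density q t).
Proof.
rewrite density_bmul !(@density_nerve_map _ A AA) //=; last first.
- by move=> x y; rewrite /= one2.
- by move=> x y; rewrite /= one2.
by congr pair; [exact: (Monoid.mulm1 (cmul hA))|exact: (cmul1 hA)].
Qed.

Definition realize_pair (z : kprod (bar_space R A) (bar_space R A)) :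
    realization R NN :=
  realize_map nerve_unzip (pair_bar z.1 z.2).

Lemma realize_prod_unzip (z : bar_space R AA) :
  realize_prod (realize_map nerve_unzip z : realization R NN) =
  (realize_map (@nerve_map AA A fst) z, realize_map (@nerve_map AA A snd) z).
Proof.
have [n [a [v ->]]] := rpi_surj z; rewrite /realize_prod.
rewrite (realize_mapE nerve_unzip_simplicial).
rewrite (realize_mapE (@fst_simplicial _ _))
  (realize_mapE (@snd_simplicial _ _)).
by rewrite !(realize_mapE (@nerve_map_simplicial AA A _ _ _)).
Qed.

Lemma realize_unzip_zip (z : realization R NN) :
  realize_map nerve_unzip (realize_map nerve_zip z : bar_space R AA) = z.
Proof.
have [n [[a b] [v ->]]] := rpi_surj z.
by rewrite (realize_mapE nerve_zip_simplicial)
  (realize_mapE nerve_unzip_simplicial).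
Qed.

Lemma realize_pairK : cancel realize_pair (@realize_prod R (nerve A) (nerve A)).
Proof.
move=> [p q]; rewrite realize_prod_unzip /=; congr pair.
  by apply: density_inj => // t;
    rewrite (@density_nerve_map _ AA A) // density_pair_bar.
by apply: density_inj => // t;
  rewrite (@density_nerve_map _ AA A) // density_pair_bar.
Qed.

Lemma realize_prodK : cancel (@realize_prod R (nerve A) (nerve A)) realize_pair.
Proof.
(* Writing [z] as the image of a point of B(A x A) reduces the claim to an equality of densities. *)
move=> z; rewrite -[z in RHS]realize_unzip_zip -[z in LHS]realize_unzip_zip.
rewrite realize_prod_unzip /realize_pair; congr realize_map => /=.
apply: (@density_inj R AA) => // t;
  rewrite density_pair_bar !(@density_nerve_map _ AA A) //.
by rewrite -surjective_pairing.
Qed.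

Lemma realize_prod_continuous :
  continuous (@realize_prod R (nerve A) (nerve A)).
Proof.
apply: kprod_pair_continuous; first exact: realization_kspace.
- apply: realize_map_continuous; first exact: fst_simplicial.
  by move=> n; exact: kprod_fst_continuous.
- apply: realize_map_continuous; first exact: snd_simplicial.
  by move=> n; exact: kprod_snd_continuous.
Qed.

Lemma realize_pair_continuous : continuous realize_pair.
Proof.
move=> z; apply: (@continuous_comp _ _ _
  (fun z : kprod (bar_space R A) (bar_space R A) => pair_bar z.1 z.2)
  (realize_map nerve_unzip)); last first.
  apply: realize_map_continuous; first exact: nerve_unzip_simplicial.
  exact: nerve_unzip_continuous.
apply: (@continuous_comp _ _ _
  (fun z : kprod (bar_space R A) (bar_space R A) =>
    (realize_map (@nerve_map A AA (fun a => (a, c2one))) z.1,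
     realize_map (@nerve_map A AA (fun a => (c2one, a))) z.2) :
    kprod (bar_space R AA) (bar_space R AA))
  (fun w => bmul hAA w.1 w.2)); last exact: bmul_continuous.
have kA : kspace A by case: hA => -[[]].
apply: kprod_pair_continuous; first exact: kify_kspace.
- move=> {}z; apply: continuous_comp; first exact: kprod_fst_continuous.
  apply: realize_nerve_map_continuous => // [x y|]; first by rewrite /= one2.
  apply: kprod_pair_continuous => //; first by move=> x; exact: cvg_id.
  exact: cst_continuous.
- move=> {}z; apply: continuous_comp; first exact: kprod_snd_continuous.
  apply: realize_nerve_map_continuous => // [x y|]; first by rewrite /= one2.
  apply: kprod_pair_continuous => //; first exact: cst_continuous.
  by move=> x; exact: cvg_id.
Qed.

Lemma bar_mul_wd : bar_mul_well_defined R A.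
Proof.
exists realize_pair; split.
- exact: realize_prodK.
- exact: realize_pairK.
- exact: realize_prod_continuous.
- exact: realize_pair_continuous.
Qed.

(** Surjectivity of [realize_prod] puts [p] and [q] on a common simplex point, where the product is
    levelwise and commutativity splits the product of the [a j * b j]. *)
Lemma density_bar_mul (p q : bar_space R A) t :
  density (bar_mul p q) t = c2mul (density p t) (density q t).
Proof.
have [z pE qE] : exists2 z : realization R NN, p = (realize_prod z).1 & q =
  (realize_prod z).2.
  by exists (realize_pair (p, q)); rewrite realize_pairK.
rewrite pE qE (bar_mulE bar_mul_wd) /realize_prod {pE qE}.
have [n [[a b] [v ->]]] := rpi_surj z.
rewrite (realize_mapE (nerve_mul_simplicial (cmulA hA) (cmulC hA) (cmul1 hA))).
rewrite (realize_mapE (@fst_simplicial _ _))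
  (realize_mapE (@snd_simplicial _ _)).
rewrite !(density_rpi hA) /cell_density -[@c2mul A]/(cmul hA).
by case: ifP => _; rewrite ?Monoid.mul1m // -big_split.
Qed.

Lemma bar_mul_bmul (p q : bar_space R A) : bar_mul p q = bmul hA p q.
Proof.
by apply: density_inj => // t; rewrite density_bar_mul density_bmul.
Qed.

End RealizeProd.

(** * Iterated bar constructions *)

Section BarMonoid.
Variables (R : realType) (A : c2magma) (hA : com_c2_monoid A).

(** [bar] and [tbar] differ only in the involution. The monoid laws follow pointwise from densities,
    and continuity of the product comes from [bmul]. *)
Lemma bar_com_of_tau (tau : bar_space R A -> bar_space R A) :
  continuous tau -> involutive tau -> tau (bar_one R A) = bar_one R A ->
  {morph tau : p q / bar_mul p q} ->
  com_c2_monoid (C2Magma (@bar_mul R A) (bar_one R A) tau).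
Proof.
move=> ct tK t1 tM.
split; [split; [split=> //|split|]|] => /=.
- exact: realization_kspace.
- suff e : @bar_mul R A = bmul hA by have := @bmul_continuous R A hA;
  rewrite -e.
  by apply: funext => p; apply: funext => q; exact: bar_mul_bmul.
- move=> p q r; apply: density_inj => // t; rewrite !(density_bar_mul hA).
  exact: (cmulA hA).
- move=> p; apply: density_inj => // t;
  rewrite (density_bar_mul hA) density_one //.
  exact: (cmul1 hA).
- move=> p; apply: density_inj => // t;
  rewrite (density_bar_mul hA) density_one //.
  exact: (Monoid.mulm1 (cmul hA)).
- exact: tM.
- move=> p q; apply: density_inj => // t; rewrite !(density_bar_mul hA).
  exact: (cmulC hA).
Qed.

Lemma density_nerve_tau (p : bar_space R A) t :
  density (realize_map (@nerve_tau A) p : bar_space R A)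
    t = c2tau (density p t).
Proof.
case: (hA) => -[[_ _ _ t1] _ tM] _.
exact: (density_nerve_map p t hA hA tM t1).
Qed.

(** Reversing the simplex point reflects positions by [simplex_rev_pos], and reversing the labels
    keeps each with its position. Commutativity absorbs the reversed order of the factors. *)
Lemma density_nerve_revtau (p : bar_space R A) t :
  density (realize_flip (@nerve_revtau A) p : bar_space R A) t =
  c2tau (density p (1 - t)).
Proof.
have [[[_ _ _ t1] _ tM] _] := hA.
have [n [a [v ->]]] := rpi_surj p.
rewrite (realize_flipE (nerve_revtau_antisimplicial
  (com_c2_monoid_twisted hA))).
rewrite !(density_rpi hA) /cell_density.
rewrite subr_gt0 [1 - t < 1]ltrBlDr ltrDl andbC; case: ifP => // _.
rewrite (big_morph c2tau tM t1) -[@c2mul A]/(cmul hA) (reindex_inj rev_ord_inj)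
  /=.
apply: eq_big => [j|j _]; last by rewrite /nerve_revtau rev_ordK.
rewrite (simplex_rev_pos v (rev_ord j)) rev_ordK.
by apply/eqP/eqP => [<-|->]; rewrite subKr.
Qed.

Lemma bar_com : com_c2_monoid (bar R A).
Proof.
have [[[_ ct tK t1] _ tM] _] := hA.
apply: bar_com_of_tau.
- exact: (realize_nerve_map_continuous tM t1 ct).
- by move=> p; apply: density_inj => // t; rewrite !density_nerve_tau tK.
- by apply: density_inj => // t; rewrite density_nerve_tau !density_one.
- move=> p q; apply: density_inj => // t.
  by rewrite density_nerve_tau !density_bar_mul // !density_nerve_tau tM.
Qed.

Lemma tbar_com : com_c2_monoid (tbar R A).
Proof.
have [[[_ ct tK t1] _ tM] _] := hA.
apply: bar_com_of_tau.
- apply: realize_flip_continuous.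
    exact: (nerve_revtau_antisimplicial (com_c2_monoid_twisted hA)).
  move=> n; apply: kpow_continuous => [|j]; first exact: kify_kspace.
  move=> a; apply: (@continuous_comp _ _ _ (fun a : kpow A n => a (rev_ord j))
    (@c2tau A)).
    exact: kpow_proj_continuous.
  exact: ct.
- by move=> p; apply: density_inj => // t;
  rewrite !density_nerve_revtau tK subKr.
- by apply: density_inj => // t; rewrite density_nerve_revtau !density_one.
- move=> p q; apply: density_inj => // t.
  by rewrite density_nerve_revtau !density_bar_mul // !density_nerve_revtau tM.
Qed.

End BarMonoid.

(** * Naturality in the monoid *)

Section BarMorphism.
Variables (R : realType) (A B : c2magma) (f : A -> B).
Hypotheses (hA : com_c2_monoid A) (hB : com_c2_monoid B).
Hypothesis hf : c2_monoid_morphism f.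

Let dE (p : bar_space R A) t :
  density (realize_map (@nerve_map A B f) p : bar_space R B)
    t = f (density p t).
Proof. by case: hf => _ fM f1 _; exact: density_nerve_map. Qed.

Lemma bar_map_morphism : c2_monoid_morphism (bar_map R f).
Proof.
have [cf fM f1 ft] := hf; split.
- exact: realize_nerve_map_continuous.
- move=> p q; apply: density_inj => // t.
  by rewrite dE !density_bar_mul // !dE fM.
- by apply: density_inj => // t; rewrite dE !density_one.
- move=> p; apply: density_inj => // t.
  by rewrite dE !density_nerve_tau // dE ft.
Qed.

Lemma tbar_map_morphism : c2_monoid_morphism (tbar_map R f).
Proof.
have [cf fM f1 ft] := hf; split.
- exact: realize_nerve_map_continuous.
- move=> p q; apply: density_inj => // t.
  by rewrite dE !density_bar_mul // !dE fM.
- by apply: density_inj => // t; rewrite dE !density_one.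
- move=> p; apply: density_inj => // t.
  by rewrite dE !density_nerve_revtau // dE ft.
Qed.

End BarMorphism.

(** * Transposition of the double bar construction *)

Section Transpose.
Variables (R : realType) (A : c2magma) (hA : com_c2_monoid A).
Let BA := bar R A.
(** As [bar] and [tbar] share carrier, product and unit, this space underlies both double bar
    constructions, up to conversion. *)
Let BBA := bar_space R BA.
Let hBA : com_c2_monoid BA := bar_com R hA.

Lemma density2_inj (p q : BBA) :
  (forall s t, density (density p s : bar_space R A) t =
               density (density q s : bar_space R A) t) -> p = q.
Proof.
by move=> pq; apply: (density_inj hBA) => s; apply: (density_inj hA) => t;
  exact: pq.
Qed.

Definition point (s : R) (a : A) : BA := conf (fun _ : 'I_1 => a) (fun=> s).

Lemma density_point s a t :
  density (point s a : bar_space R A) t = if (0 < t < 1) && (s == t)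
    then a else c2one.
Proof.
rewrite /point (density_conf hA); case: ifP => //= _.
by rewrite -[@c2mul A]/(cmul hA) big_mkcond big_ord1.
Qed.

Lemma point_mul s : {morph point s : a b / c2mul a b}.
Proof.
move=> a b; apply: (density_inj hA) => t.
rewrite (density_bar_mul hA) !density_point.
by case: ifP => // _; exact: esym (cmul1 hA _).
Qed.

Lemma point_one s : point s c2one = c2one.
Proof.
by apply: (density_inj hA) => t; rewrite density_point density_one //;
  case: ifP.
Qed.

(** The bar construction applied to the morphism [point s]: it places the density of [b] on the line
    of the square where the second coordinate is [s]. *)
Definition bar_point (b : BA) (s : R) : BBA :=
  realize_map (@nerve_map A BA (point s)) b.

Lemma density_bar_point b s t t' :
  density (density (bar_point b s) t : bar_space R A) t' =
  if (0 < t' < 1) && (s == t') then density (b : bar_space R A) t else c2one.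
Proof.
rewrite (density_nerve_map _ _ hA hBA (point_mul s) (point_one s)).
exact: density_point.
Qed.

(** Joint continuity in [b] and [s]: on a cell only the labels involve [s], and these are
    configurations of one label. *)
Lemma bar_point_continuous :
  continuous (fun p : kprod BA R => bar_point p.1 p.2).
Proof.
apply: realization_kprod_continuous => n.
pose C := kprod (nerve A n) (simplex R n).
have c1 : continuous (fun p : kprod C R => p.1) by exact: kprod_fst_continuous.
rewrite (_ : (fun p => _) = fun p : kprod C R =>
    rpi ((fun j => point p.2 (p.1.1 j)) : nerve BA n) p.1.2); last first.
  apply: funext => p.
  by rewrite /bar_point (realize_mapE (nerve_map_simplicial (point_mul _)
    (point_one _))).
apply: rpi_continuous; first exact: kify_kspace.
- apply: kpow_continuous => [|j]; first exact: kify_kspace.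
  apply: conf_continuous => // [|i|i]; first exact: kify_kspace.
  + move=> p; apply: (@continuous_comp _ _ _ (fst : kprod C R -> C)
    (fun c : C => c.1 j)).
      exact: c1.
    apply: (@continuous_comp _ _ _ (fst : C -> kpow A n) (fun a => a j)).
      exact: kprod_fst_continuous.
    exact: kpow_proj_continuous.
  + exact: kprod_snd_continuous.
- move=> p; apply: (@continuous_comp _ _ _ (fst : kprod C R -> C)
  (fun c : C => c.2)).
    exact: c1.
  exact: kprod_snd_continuous.
Qed.

(** A point labelled [b i] in [BA] at position [s] is transposed to the image of
    [b i] under the morphism [point s : A -> BA], so that continuity of the
    transposition reduces to that of the product of [BBA]. *)
Definition cell_transpose n (b : nerve BA n) (v : simplex R n) : BBA :=
  \big[bmul hBA/bar_one R BA]_(i < n) bar_point (b i) (pos v i).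

(** Evaluation at [t] and then at [t'] is multiplicative, so the product is evaluated factor by
    factor. Only factors with [pos v i] equal to [t'] contribute, as in the density of [rpi b v] at
    [t']. *)
Lemma density_cell_transpose n (b : nerve BA n) (v : simplex R n) t t' :
  density (density (cell_transpose b v) t : bar_space R A) t' =
  density (density (rpi b v) t' : bar_space R A) t.
Proof.
rewrite /cell_transpose.
rewrite (big_morph (fun p : BBA => density p t) (id1 := c2one)
  (op1 := @c2mul BA));
  [|by move=> p q; rewrite density_bmul|by rewrite density_one].
have dM (u : R) := big_morph (fun p : BA => density (p : bar_space R A) u)
  (fun p q => density_bar_mul hA p q u) (@density_one R A hA u).
rewrite dM (density_rpi hBA) /cell_density.
under eq_bigr do rewrite density_bar_point.
rewrite -[@c2mul A]/(cmul hA); case: ifP => /= _;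
  last by rewrite big1_eq density_one.
by rewrite dM -[@c2mul A]/(cmul hA) -big_mkcond.
Qed.

Lemma transpose_ex (p : BBA) : exists q : BBA, forall t t',
  density (density q t : bar_space R A)
    t' = density (density p t' : bar_space R A) t.
Proof.
have [n [b [v ->]]] := rpi_surj p.
by exists (cell_transpose b v); exact: density_cell_transpose.
Qed.

(** Being characterized by its density, it needs no separate check of compatibility with the
    gluing. *)
Definition transpose (p : BBA) : BBA := sval (cid (transpose_ex p)).

Lemma density_transpose p t t' :
  density (density (transpose p) t : bar_space R A) t' =
  density (density p t' : bar_space R A) t.
Proof. by rewrite /transpose; case: cid. Qed.

Lemma transposeK : involutive transpose.
Proof. by move=> p; apply: density2_inj => s t; rewrite !density_transpose. Qed.

Lemma transpose_rpi n (b : nerve BA n) (v : simplex R n) :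
  transpose (rpi b v) = cell_transpose b v.
Proof.
apply: density2_inj => s t.
by rewrite density_transpose density_cell_transpose.
Qed.

Lemma big_bmul_continuous (X : topologicalType) (I : Type) (r : seq I)
    (F : I -> X -> BBA) :
  kspace X -> (forall i, continuous (F i)) ->
  continuous (fun x => \big[bmul hBA/bar_one R BA]_(i <- r) F i x).
Proof.
move=> kX cF; elim: r => [|i r IH].
  under eq_fun do rewrite big_nil; exact: cst_continuous.
under eq_fun do rewrite big_cons.
move=> x; apply: (@continuous_comp _ _ _
  (fun x => (F i x, \big[bmul hBA/bar_one R BA]_(j <- r) F j x) : kprod BBA BBA)
  (fun p => bmul hBA p.1 p.2)); last exact: bmul_continuous.
exact: kprod_pair_continuous.
Qed.

Lemma transpose_continuous : continuous transpose.
Proof.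
apply: realization_continuous => n.
under eq_fun do rewrite transpose_rpi.
apply: big_bmul_continuous => [|i]; first exact: kify_kspace.
pose C := kprod (nerve BA n) (simplex R n).
move=> p; apply: (@continuous_comp _ _ _
  (fun p : C => (p.1 i, pos p.2 i) : kprod BA R) (fun q => bar_point q.1 q.2));
    last first.
  exact: bar_point_continuous.
apply: kprod_pair_continuous; first exact: kify_kspace.
- move=> {}p; apply: (@continuous_comp _ _ _ (fst : C -> kpow BA n)
  (fun a => a i)).
    exact: kprod_fst_continuous.
  exact: kpow_proj_continuous.
- by apply: pos_continuous; exact: kprod_snd_continuous.
Qed.

Lemma transpose_tau (p : BBA) :
  transpose (realize_map (@nerve_tau (tbar R A)) (p : bar_space R (tbar R A))) =
  realize_flip (@nerve_revtau BA) (transpose p).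
Proof.
apply: density2_inj => s t.
rewrite density_transpose (density_nerve_revtau hBA) (density_nerve_tau hA).
rewrite density_transpose.
(* The outer involution acts on labels by that of [tbar R A], which is a flip; the ascription to
   [BBA] passes between the two convertible carriers. *)
have e : density (realize_map (@nerve_tau (tbar R A)) p : BBA) t =
    realize_flip (@nerve_revtau A) (density p t : bar_space R A).
  exact: (@density_nerve_tau R (tbar R A) (tbar_com R hA)).
rewrite (congr1 (fun q : bar_space R A => density q s) e).
exact: (density_nerve_revtau hA).
Qed.

End Transpose.

Theorem proposition4p2 (R : realType) (A : c2magma) (hA : com_c2_monoid A) :
  (* [B] and [B^sigma] may be applied again, and all four products exist *)
  [/\ com_c2_monoid (tbar R A), com_c2_monoid (bar R A),
      bar_mul_well_defined R A, bar_mul_well_defined R (tbar R A)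
    & bar_mul_well_defined R (bar R A)] /\
  (* the commutative monoid structures on B B^sigma A and B^sigma B A *)
  [/\ com_c2_monoid (bar R (tbar R A)), com_c2_monoid (tbar R (bar R A))
    & forall (A' : c2magma) (f : A -> A'),
        com_c2_monoid A' -> c2_monoid_morphism f ->
        c2_monoid_morphism (bar_map R (tbar_map R f)) /\
        c2_monoid_morphism (tbar_map R (bar_map R f))] /\
  exists h : bar R (tbar R A) -> tbar R (bar R A), c2_homeomorphism h.
Proof.
have [hB hT] := (bar_com R hA, tbar_com R hA).
split; first by split=> //; exact: bar_mul_wd.
split; first split.
- exact: bar_com.
- exact: tbar_com.
- move=> A' f hA' hf; split.
  + apply: bar_map_morphism; [exact: hT|exact: tbar_com|exact: tbar_map_morphism].
  + apply: tbar_map_morphism; [exact: hB|exact: bar_com|exact: bar_map_morphism].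
(* Both double bar constructions have the carrier [BBA], and [transpose] is its own inverse
   there. *)
exists (@transpose R A hA); split; last by move=> p; exact: transpose_tau.
exists (@transpose R A hA); split; first exact: transposeK.
- exact: transposeK.
- exact: transpose_continuous.
- exact: transpose_continuous.
Qed.
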